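(* Let $\mathsf{B}$ and $\mathsf{C}$ be bicategories, let $L:\mathsf{B}\to\mathsf{C}$ be a biequivalence, and let $\mathsf{D}_1$ and $\mathsf{D}_2$ be displayed bicategories over $\mathsf{B}$ and $\mathsf{C}$, respectively. Then each displayed biequivalence $\bar L$ from $\mathsf{D}_1$ to $\mathsf{D}_2$ over $L$ gives rise to a biequivalence $\int\bar L$ from the total bicategory $\int\mathsf{D}_1$ to the total bicategory $\int\mathsf{D}_2$.
   Context: We work in Martin-Löf type theory with function extensionality (univalent foundations). Bicategories have types of objects and 1-cells and sets of 2-cells, with the usual operations and axioms; 1-cell and pseudofunctor composition $\cdot$ is in diagrammatic order, $\bullet$ is vertical composition. Pseudofunctors $F$ (with invertible identitor $F_i(a):\mathrm{id}_1(F(a))\Rightarrow F(\mathrm{id}_1(a))$ and compositor $F_c(f,g):F(f)\cdot F(g)\Rightarrow F(f\cdot g)$), pseudotransformations $\eta:F\Rightarrow G$ (1-cells $\eta_0(a):F(a)\to G(a)$ and invertible 2-cells $\eta_1(f):\eta_0(a)\cdot G(f)\Rightarrow F(f)\cdot\eta_0(b)$) and modifications are the usual notions. A biequivalence from $\mathsf{B}$ to $\mathsf{C}$ consists of pseudofunctors $L:\mathsf{B}\to\mathsf{C}$ and $R:\mathsf{C}\to\mathsf{B}$; pseudotransformations $\eta:R\cdot L\Rightarrow\mathrm{id}(\mathsf{C})$, $\eta_i:\mathrm{id}(\mathsf{C})\Rightarrow R\cdot L$, $\varepsilon:L\cdot R\Rightarrow\mathrm{id}(\mathsf{B})$, $\varepsilon_i:\mathrm{id}(\mathsf{B})\Rightarrow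 L\cdot R$; and invertible modifications $m_1:\eta\bullet\eta_i\Rrightarrow\mathrm{id}$, $m_2:\eta_i\bullet\eta\Rrightarrow\mathrm{id}$, $m_3:\varepsilon\bullet\varepsilon_i\Rrightarrow\mathrm{id}$, $m_4:\varepsilon_i\bullet\varepsilon\Rrightarrow\mathrm{id}$. A displayed bicategory $\mathsf{D}$ over $\mathsf{B}$ consists of: for each $a:\mathsf{B}_0$ a type $\mathsf{D}_a$ of displayed objects; for each $f:a\to b$, $\bar a:\mathsf{D}_a$, $\bar b:\mathsf{D}_b$ a type $\bar a\xrightarrow{f}\bar b$ of displayed 1-cells; for each $\theta:f\Rightarrow g$, $\bar f:\bar a\xrightarrow{f}\bar b$, $\bar g:\bar a\xrightarrow{g}\bar b$ a set $\bar f\xRightarrow{\theta}\bar g$ of displayed 2-cells; displayed versions of all bicategory operations, each lying over the corresponding operation of $\mathsf{B}$; and displayed versions of all axioms, each a dependent equality over the corresponding axiom of $\mathsf{B}$. The total bicategory $\int\mathsf{D}$ has pairs $(a,\bar a)$, $(f,\bar f)$, $(\theta,\bar\theta)$ as cells, with componentwise operations. A displayed 2-cell over an invertible $\theta$ is invertible if it has a two-sided inverse over $\theta^{-1}$ (modulo transport along the inverse laws of $\theta$). Given $F:\mathsf{B}\to\mathsf{C}$, a displayed pseudofunctor $\bar F$ from $\mathsf{D}_1$ to $\mathsf{D}_2$ over $F$ consists of maps sending displayed objects over $a$ to displayed objects over $F(a)$, displayed 1-cells $\bar a\xrightarrow{f}\bar b$ to displayed 1-cells $\bar F(\bar a)\xrightarrow{F(f)}\bar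 F(\bar b)$, displayed 2-cells over $\theta$ to displayed 2-cells over $F(\theta)$, displayed invertible 2-cells $\mathrm{id}_1(\bar F(\bar a))\xRightarrow{F_i(a)}\bar F(\mathrm{id}_1(\bar a))$ and $\bar F(\bar f)\cdot\bar F(\bar g)\xRightarrow{F_c(f,g)}\bar F(\bar f\cdot\bar g)$, satisfying the pseudofunctor laws displayed over those of $F$. Given $\eta:F\Rightarrow G$ and displayed pseudofunctors $\bar F,\bar G$ over $F,G$, a displayed pseudotransformation $\bar\eta:\bar F\Rightarrow\bar G$ over $\eta$ consists of displayed 1-cells $\bar\eta_0(\bar x):\bar F(\bar x)\xrightarrow{\eta_0(x)}\bar G(\bar x)$ and displayed invertible 2-cells $\bar\eta_0(\bar x)\cdot\bar G(\bar f)\xRightarrow{\eta_1(f)}\bar F(\bar f)\cdot\bar\eta_0(\bar y)$ satisfying the pseudotransformation laws displayed over those of $\eta$. Given a modification $m:\eta\Rrightarrow\theta$, a displayed modification over $m$ from $\bar\eta$ to $\bar\theta$ consists of displayed 2-cells $\bar\eta_0(\bar x)\xRightarrow{m(x)}\bar\theta_0(\bar x)$ satisfying the modification law displayed over that of $m$; it is invertible (over an invertible $m$) if each of these displayed 2-cells is invertible. Displayed identities and compositions of displayed pseudofunctors and pseudotransformations are defined componentwise, over the ordinary ones. A displayed biequivalence $\bar L$ from $\mathsf{D}_1$ to $\mathsf{D}_2$ over a biequivalence $(L,R,\eta,\eta_i,\varepsilon,\varepsilon_i,m_1,\dots,m_4)$ consists of displayed pseudofunctors $\bar L:\mathsf{D}_1\to\mathsf{D}_2$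 over $L$ and $\bar R:\mathsf{D}_2\to\mathsf{D}_1$ over $R$; displayed pseudotransformations $\bar\eta:\bar R\cdot\bar L\Rightarrow\mathrm{id}(\mathsf{D}_2)$ over $\eta$, $\bar\eta_i:\mathrm{id}(\mathsf{D}_2)\Rightarrow\bar R\cdot\bar L$ over $\eta_i$, $\bar\varepsilon:\bar L\cdot\bar R\Rightarrow\mathrm{id}(\mathsf{D}_1)$ over $\varepsilon$, $\bar\varepsilon_i:\mathrm{id}(\mathsf{D}_1)\Rightarrow\bar L\cdot\bar R$ over $\varepsilon_i$; and displayed invertible modifications from $\bar\eta\bullet\bar\eta_i$, $\bar\eta_i\bullet\bar\eta$, $\bar\varepsilon\bullet\bar\varepsilon_i$, $\bar\varepsilon_i\bullet\bar\varepsilon$ to the respective displayed identities, over $m_1,m_2,m_3,m_4$. The total pseudofunctor $\int\bar L:\int\mathsf{D}_1\to\int\mathsf{D}_2$ acts componentwise, e.g. $(x,\bar x)\mapsto(L(x),\bar L(\bar x))$; it is the underlying pseudofunctor of the biequivalence $\int\bar L$. *)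

(* Defs.v *)
From Stdlib Require Import ssreflect EqdepFacts.
Import EqNotations.

Set Implicit Arguments.
Unset Strict Implicit.
Unset Printing Implicit Defensive.

Declare Scope bicat_scope.
Delimit Scope bicat_scope with bicat.
Open Scope bicat_scope.

Reserved Notation "a --> b" (at level 55, no associativity).
Reserved Notation "f ==> g" (at level 60, no associativity).
Reserved Notation "f · g" (at level 40, left associativity).
Reserved Notation "x • y" (at level 50, left associativity).
Reserved Notation "f ◃ x" (at level 45, no associativity).
Reserved Notation "x ▹ f" (at level 45, no associativity).

Record bicat_data := {
  ob :> Type;
  hom : ob -> ob -> Type;
  cell : forall {a b : ob}, hom a b -> hom a b -> Type;
  id1 : forall a : ob, hom a a;
  comp1 : forall {a b c : ob}, hom a b -> hom b c -> hom a c;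
  id2 : forall {a b : ob} (f : hom a b), cell f f;
  vcomp : forall {a b : ob} {f g h : hom a b}, cell f g -> cell g h -> cell f h;
  lwhisker : forall {a b c : ob} (f : hom a b) {g h : hom b c},
    cell g h -> cell (comp1 f g) (comp1 f h);
  rwhisker : forall {a b c : ob} {f g : hom a b} (h : hom b c),
    cell f g -> cell (comp1 f h) (comp1 g h);
  lunitor : forall {a b : ob} (f : hom a b), cell (comp1 (id1 a) f) f;
  linvunitor : forall {a b : ob} (f : hom a b), cell f (comp1 (id1 a) f);
  runitor : forall {a b : ob} (f : hom a b), cell (comp1 f (id1 b)) f;
  rinvunitor : forall {a b : ob} (f : hom a b), cell f (comp1 f (id1 b));
  lassociator : forall {a b c d : ob} (f : hom a b) (g : hom b c) (h : hom c d),
    cell (comp1 f (comp1 g h)) (comp1 (comp1 f g) h);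
  rassociator : forall {a b c d : ob} (f : hom a b) (g : hom b c) (h : hom c d),
    cell (comp1 (comp1 f g) h) (comp1 f (comp1 g h))
}.

Arguments hom {b} : rename.
Arguments id1 {b} a : rename.

Notation "a --> b" := (hom a b) : bicat_scope.
Notation "f ==> g" := (cell f g) : bicat_scope.
Notation "f · g" := (comp1 f g) : bicat_scope.
Notation "x • y" := (vcomp x y) : bicat_scope.
Notation "f ◃ x" := (lwhisker f x) : bicat_scope.
Notation "x ▹ f" := (rwhisker f x) : bicat_scope.

Record bicat := {
  bicat_ops :> bicat_data;
  id2_left : forall (a b : bicat_ops) (f g : a --> b) (x : f ==> g),
    id2 f • x = x;
  id2_right : forall (a b : bicat_ops) (f g : a --> b) (x : f ==> g),
    x • id2 g = x;
  vassocr : forall (a b : bicat_ops) (f g h k : a --> b)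
      (x : f ==> g) (y : g ==> h) (z : h ==> k),
    x • (y • z) = (x • y) • z;
  lwhisker_id2 : forall (a b c : bicat_ops) (f : a --> b) (g : b --> c),
    f ◃ id2 g = id2 (f · g);
  id2_rwhisker : forall (a b c : bicat_ops) (f : a --> b) (g : b --> c),
    id2 f ▹ g = id2 (f · g);
  lwhisker_vcomp : forall (a b c : bicat_ops) (f : a --> b) (g h k : b --> c)
      (x : g ==> h) (y : h ==> k),
    (f ◃ x) • (f ◃ y) = f ◃ (x • y);
  rwhisker_vcomp : forall (a b c : bicat_ops) (f g h : a --> b) (k : b --> c)
      (x : f ==> g) (y : g ==> h),
    (x ▹ k) • (y ▹ k) = (x • y) ▹ k;
  vcomp_lunitor : forall (a b : bicat_ops) (f g : a --> b) (x : f ==> g),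
    (id1 a ◃ x) • lunitor g = lunitor f • x;
  vcomp_runitor : forall (a b : bicat_ops) (f g : a --> b) (x : f ==> g),
    (x ▹ id1 b) • runitor g = runitor f • x;
  lwhisker_lwhisker : forall (a b c d : bicat_ops) (f : a --> b) (g : b --> c)
      (h i : c --> d) (x : h ==> i),
    (f ◃ (g ◃ x)) • lassociator f g i = lassociator f g h • (f · g ◃ x);
  rwhisker_lwhisker : forall (a b c d : bicat_ops) (f : a --> b) (g h : b --> c)
      (i : c --> d) (x : g ==> h),
    (f ◃ (x ▹ i)) • lassociator f h i = lassociator f g i • ((f ◃ x) ▹ i);
  rwhisker_rwhisker : forall (a b c d : bicat_ops) (f g : a --> b) (h : b --> c)
      (i : c --> d) (x : f ==> g),
    lassociator f h i • ((x ▹ h) ▹ i) = (x ▹ h · i) • lassociator g h i;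
  vcomp_whisker : forall (a b c : bicat_ops) (f g : a --> b) (h i : b --> c)
      (x : f ==> g) (y : h ==> i),
    (x ▹ h) • (g ◃ y) = (f ◃ y) • (x ▹ i);
  lunitor_linvunitor : forall (a b : bicat_ops) (f : a --> b),
    lunitor f • linvunitor f = id2 (id1 a · f);
  linvunitor_lunitor : forall (a b : bicat_ops) (f : a --> b),
    linvunitor f • lunitor f = id2 f;
  runitor_rinvunitor : forall (a b : bicat_ops) (f : a --> b),
    runitor f • rinvunitor f = id2 (f · id1 b);
  rinvunitor_runitor : forall (a b : bicat_ops) (f : a --> b),
    rinvunitor f • runitor f = id2 f;
  lassociator_rassociator : forall (a b c d : bicat_ops)
      (f : a --> b) (g : b --> c) (h : c --> d),
    lassociator f g h • rassociator f g h = id2 (f · (g · h));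
  rassociator_lassociator : forall (a b c d : bicat_ops)
      (f : a --> b) (g : b --> c) (h : c --> d),
    rassociator f g h • lassociator f g h = id2 ((f · g) · h);
  runitor_rwhisker : forall (a b c : bicat_ops) (f : a --> b) (g : b --> c),
    lassociator f (id1 b) g • (runitor f ▹ g) = f ◃ lunitor g;
  lassociator_lassociator : forall (a b c d e : bicat_ops)
      (f : a --> b) (g : b --> c) (h : c --> d) (i : d --> e),
    ((f ◃ lassociator g h i) • lassociator f (g · h) i) • (lassociator f g h ▹ i)
    = lassociator f g (h · i) • lassociator (f · g) h i;
  (* [UIP_]: 2-cells form a set; objects and 1-cells are arbitrary types. *)
  cell_set : forall (a b : bicat_ops) (f g : a --> b), UIP_ (f ==> g)
}.

Record is_invertible {B : bicat} {a b : B} {f g : a --> b} (x : f ==> g) := {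
  inv_cell : g ==> f;
  inv_cell_right : x • inv_cell = id2 f;
  inv_cell_left : inv_cell • x = id2 g
}.

Section Calculus.
Context {B : bicat}.

Lemma vcomp_cancel_inv_r {a b : B} {f g h : a --> b} (x y : f ==> g) (z : g ==> h) :
  is_invertible z -> x • z = y • z -> x = y.
Proof.
move=> [w zw wz] e.
by rewrite -(id2_right x) -(id2_right y) -zw !vassocr e.
Qed.

Lemma vcomp_cancel_inv_l {a b : B} {f g h : a --> b} (x y : g ==> h) (z : f ==> g) :
  is_invertible z -> z • x = z • y -> x = y.
Proof.
move=> [w zw wz] e.
by rewrite -(id2_left x) -(id2_left y) -wz -!vassocr e.
Qed.

Definition vcomp_inv {a b : B} {f g h : a --> b} {x : f ==> g} {y : g ==> h}
  (ix : is_invertible x) (iy : is_invertible y) : is_invertible (x • y).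
Proof.
exists (inv_cell iy • inv_cell ix).
- abstract (by rewrite -vassocr (vassocr y) inv_cell_right id2_left inv_cell_right).
- abstract (by rewrite -vassocr (vassocr _ x) inv_cell_left id2_left inv_cell_left).
Defined.

Definition id2_inv {a b : B} (f : a --> b) : is_invertible (id2 f).
Proof. by exists (id2 f); abstract (exact: id2_left). Defined.

Definition lunitor_inv {a b : B} (f : a --> b) : is_invertible (lunitor f) :=
  {| inv_cell_right := lunitor_linvunitor f; inv_cell_left := linvunitor_lunitor f |}.
Definition runitor_inv {a b : B} (f : a --> b) : is_invertible (runitor f) :=
  {| inv_cell_right := runitor_rinvunitor f; inv_cell_left := rinvunitor_runitor f |}.
Definition rinvunitor_inv {a b : B} (f : a --> b) : is_invertible (rinvunitor f) :=
  {| inv_cell_right := rinvunitor_runitor f; inv_cell_left := runitor_rinvunitor f |}.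
Definition lassociator_inv {a b c d : B} (f : a --> b) (g : b --> c) (h : c --> d) :
  is_invertible (lassociator f g h) :=
  {| inv_cell_right := lassociator_rassociator f g h;
     inv_cell_left := rassociator_lassociator f g h |}.
Definition rassociator_inv {a b c d : B} (f : a --> b) (g : b --> c) (h : c --> d) :
  is_invertible (rassociator f g h) :=
  {| inv_cell_right := rassociator_lassociator f g h;
     inv_cell_left := lassociator_rassociator f g h |}.

Definition lwhisker_inv {a b c : B} (f : a --> b) {g h : b --> c} {x : g ==> h}
  (ix : is_invertible x) : is_invertible (f ◃ x).
Proof.
exists (f ◃ inv_cell ix).
- abstract (by rewrite lwhisker_vcomp inv_cell_right lwhisker_id2).
- abstract (by rewrite lwhisker_vcomp inv_cell_left lwhisker_id2).
Defined.

Definition rwhisker_inv {a b c : B} {f g : a --> b} (h : b --> c) {x : f ==> g}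
  (ix : is_invertible x) : is_invertible (x ▹ h).
Proof.
exists (inv_cell ix ▹ h).
- abstract (by rewrite rwhisker_vcomp inv_cell_right id2_rwhisker).
- abstract (by rewrite rwhisker_vcomp inv_cell_left id2_rwhisker).
Defined.

Lemma rassociator_swap {a b c d : B} {f f' : a --> b} {g g' : b --> c} {h h' : c --> d}
    (x : f · (g · h) ==> f' · (g' · h')) (y : (f · g) · h ==> (f' · g') · h') :
  x • lassociator f' g' h' = lassociator f g h • y ->
  y • rassociator f' g' h' = rassociator f g h • x.
Proof.
move=> e.
apply: (vcomp_cancel_inv_l (lassociator_inv f g h)).
by rewrite !vassocr -e lassociator_rassociator id2_left -vassocr
  lassociator_rassociator id2_right.
Qed.

Lemma lwhisker_lwhisker_r {a b c d : B} (f : a --> b) (g : b --> c)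
    (h i : c --> d) (x : h ==> i) :
  (f · g ◃ x) • rassociator f g i = rassociator f g h • (f ◃ (g ◃ x)).
Proof. apply: rassociator_swap; exact: lwhisker_lwhisker. Qed.

Lemma rwhisker_lwhisker_r {a b c d : B} (f : a --> b) (g h : b --> c)
    (i : c --> d) (x : g ==> h) :
  ((f ◃ x) ▹ i) • rassociator f h i = rassociator f g i • (f ◃ (x ▹ i)).
Proof. apply: rassociator_swap; exact: rwhisker_lwhisker. Qed.

Lemma rwhisker_rwhisker_r {a b c d : B} (f g : a --> b) (h : b --> c)
    (i : c --> d) (x : f ==> g) :
  ((x ▹ h) ▹ i) • rassociator g h i = rassociator f h i • (x ▹ h · i).
Proof. apply: rassociator_swap; by rewrite rwhisker_rwhisker. Qed.

Lemma id1_lwhisker_inj {a b : B} {f g : a --> b} (x y : f ==> g) :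
  id1 a ◃ x = id1 a ◃ y -> x = y.
Proof.
move=> e; apply: (vcomp_cancel_inv_l (lunitor_inv f)).
by rewrite -!vcomp_lunitor e.
Qed.

Lemma rwhisker_id1_inj {a b : B} {f g : a --> b} (x y : f ==> g) :
  x ▹ id1 b = y ▹ id1 b -> x = y.
Proof.
move=> e; apply: (vcomp_cancel_inv_l (runitor_inv f)).
by rewrite -!vcomp_runitor e.
Qed.

Lemma lunitor_triangle {a b c : B} (f : a --> b) (g : b --> c) :
  lassociator (id1 a) f g • (lunitor f ▹ g) = lunitor (f · g).
Proof.
apply: id1_lwhisker_inj.
apply: (vcomp_cancel_inv_r (lassociator_inv _ _ _)).
rewrite -lwhisker_vcomp -vassocr rwhisker_lwhisker vassocr.
rewrite -runitor_rwhisker -rwhisker_vcomp vassocr lassociator_lassociator.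
by rewrite -vassocr rwhisker_rwhisker vassocr runitor_rwhisker.
Qed.

Lemma runitor_triangle {a b c : B} (f : a --> b) (g : b --> c) :
  lassociator f g (id1 c) • runitor (f · g) = f ◃ runitor g.
Proof.
apply: rwhisker_id1_inj.
apply: (vcomp_cancel_inv_l (lassociator_inv _ _ _)).
rewrite -rwhisker_lwhisker.
apply: (vcomp_cancel_inv_l (lwhisker_inv f (lassociator_inv _ _ _))).
rewrite (vassocr (f ◃ _) (f ◃ _)) lwhisker_vcomp runitor_rwhisker.
rewrite -rwhisker_vcomp !vassocr lassociator_lassociator.
by rewrite -vassocr runitor_rwhisker lwhisker_lwhisker.
Qed.

Lemma lunitor_id1_runitor {a : B} : lunitor (id1 a) = runitor (id1 a).
Proof.
apply: rwhisker_id1_inj.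
apply: (vcomp_cancel_inv_l (lassociator_inv _ _ _)).
rewrite lunitor_triangle runitor_rwhisker.
apply: (vcomp_cancel_inv_r (lunitor_inv _)).
by rewrite vcomp_lunitor.
Qed.

End Calculus.

Record psfunctor_data (B C : bicat) := {
  psf_ob :> B -> C;
  psf_hom : forall {a b : B}, a --> b -> psf_ob a --> psf_ob b;
  psf_cell : forall {a b : B} {f g : a --> b}, f ==> g -> psf_hom f ==> psf_hom g;
  psf_id : forall a : B, id1 (psf_ob a) ==> psf_hom (id1 a);
  psf_comp : forall {a b c : B} (f : a --> b) (g : b --> c),
    psf_hom f · psf_hom g ==> psf_hom (f · g)
}.

Notation "# F" := (psf_hom F) (at level 3, F at level 2, format "# F") : bicat_scope.
Notation "## F" := (psf_cell F) (at level 3, F at level 2, format "## F") : bicat_scope.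

Record psfunctor (B C : bicat) := {
  psf_data :> psfunctor_data B C;
  psf_id2 : forall (a b : B) (f : a --> b),
    ##psf_data (id2 f) = id2 (#psf_data f);
  psf_vcomp : forall (a b : B) (f g h : a --> b) (x : f ==> g) (y : g ==> h),
    ##psf_data (x • y) = ##psf_data x • ##psf_data y;
  psf_lunitor : forall (a b : B) (f : a --> b),
    lunitor (#psf_data f)
    = ((psf_id psf_data a ▹ #psf_data f) • psf_comp psf_data (id1 a) f)
      • ##psf_data (lunitor f);
  psf_runitor : forall (a b : B) (f : a --> b),
    runitor (#psf_data f)
    = ((#psf_data f ◃ psf_id psf_data b) • psf_comp psf_data f (id1 b))
      • ##psf_data (runitor f);
  psf_lassociator : forall (a b c d : B) (f : a --> b) (g : b --> c) (h : c --> d),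
    ((#psf_data f ◃ psf_comp psf_data g h) • psf_comp psf_data f (g · h))
      • ##psf_data (lassociator f g h)
    = (lassociator (#psf_data f) (#psf_data g) (#psf_data h)
       • (psf_comp psf_data f g ▹ #psf_data h)) • psf_comp psf_data (f · g) h;
  psf_lwhisker : forall (a b c : B) (f : a --> b) (g h : b --> c) (x : g ==> h),
    psf_comp psf_data f g • ##psf_data (f ◃ x)
    = (#psf_data f ◃ ##psf_data x) • psf_comp psf_data f h;
  psf_rwhisker : forall (a b c : B) (f g : a --> b) (h : b --> c) (x : f ==> g),
    psf_comp psf_data f h • ##psf_data (x ▹ h)
    = (##psf_data x ▹ #psf_data h) • psf_comp psf_data g h;
  psf_id_inv : forall a : B, is_invertible (psf_id psf_data a);
  psf_comp_inv : forall (a b c : B) (f : a --> b) (g : b --> c),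
    is_invertible (psf_comp psf_data f g)
}.

Definition psf_cell_inv {B C : bicat} (F : psfunctor B C) {a b : B} {f g : a --> b}
  {x : f ==> g} (ix : is_invertible x) : is_invertible (##F x).
Proof.
exists (##F (inv_cell ix)).
- abstract (by rewrite -psf_vcomp inv_cell_right psf_id2).
- abstract (by rewrite -psf_vcomp inv_cell_left psf_id2).
Defined.

Definition id_psfunctor_data (B : bicat) : psfunctor_data B B := {|
  psf_ob := fun a => a;
  psf_hom := fun a b f => f;
  psf_cell := fun a b f g x => x;
  psf_id := fun a => id2 (id1 a);
  psf_comp := fun a b c f g => id2 (f · g)
|}.

Definition id_psfunctor (B : bicat) : psfunctor B B.
Proof.
exists (id_psfunctor_data B).
1-7: abstract (by move=> *; rewrite /= ?id2_rwhisker ?lwhisker_id2 ?id2_right ?id2_left).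
- move=> a; exact: id2_inv.
- move=> a b c f g; exact: id2_inv.
Defined.

Definition comp_psfunctor_data {B C D : bicat}
  (F : psfunctor_data B C) (G : psfunctor_data C D) : psfunctor_data B D := {|
  psf_ob := fun a => G (F a);
  psf_hom := fun a b f => #G (#F f);
  psf_cell := fun a b f g x => ##G (##F x);
  psf_id := fun a => psf_id G (F a) • ##G (psf_id F a);
  psf_comp := fun a b c f g => psf_comp G (#F f) (#F g) • ##G (psf_comp F f g)
|}.

Section CompPsfunctor.
Context {B C D : bicat} (F : psfunctor B C) (G : psfunctor C D).

Lemma comp_psfunctor_lunitor (a b : B) (f : a --> b)
  (H := comp_psfunctor_data F G) :
  lunitor (#H f) = ((psf_id H a ▹ #H f) • psf_comp H (id1 a) f) • ##H (lunitor f).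
Proof.
rewrite /= psf_lunitor (psf_lunitor F) !psf_vcomp -rwhisker_vcomp !vassocr.
do 2 congr vcomp; rewrite -!vassocr; congr vcomp.
exact: psf_rwhisker.
Qed.

Lemma comp_psfunctor_runitor (a b : B) (f : a --> b)
  (H := comp_psfunctor_data F G) :
  runitor (#H f) = ((#H f ◃ psf_id H b) • psf_comp H f (id1 b)) • ##H (runitor f).
Proof.
rewrite /= psf_runitor (psf_runitor F) !psf_vcomp -lwhisker_vcomp !vassocr.
do 2 congr vcomp; rewrite -!vassocr; congr vcomp.
exact: psf_lwhisker.
Qed.

Lemma comp_psfunctor_lassociator (a b c d : B) (f : a --> b) (g : b --> c) (h : c --> d)
  (H := comp_psfunctor_data F G) :
  ((#H f ◃ psf_comp H g h) • psf_comp H f (g · h)) • ##H (lassociator f g h)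
  = (lassociator (#H f) (#H g) (#H h) • (psf_comp H f g ▹ #H h)) • psf_comp H (f · g) h.
Proof.
rewrite /= -lwhisker_vcomp -rwhisker_vcomp !vassocr.
rewrite -(vassocr _ (_ ◃ ##G _)) -psf_lwhisker.
rewrite -(vassocr _ (##G _ ▹ _)) -psf_rwhisker !vassocr -psf_lassociator.
by rewrite -!vassocr -!psf_vcomp !vassocr psf_lassociator.
Qed.

Definition comp_psfunctor : psfunctor B D.
Proof.
exists (comp_psfunctor_data F G).
- abstract (by move=> a b f; rewrite /= !psf_id2).
- abstract (by move=> a b f g h x y; rewrite /= !psf_vcomp).
- exact: comp_psfunctor_lunitor.
- exact: comp_psfunctor_runitor.
- exact: comp_psfunctor_lassociator.
- abstract (by move=> a b c f g h x /=; rewrite -vassocr -psf_vcomp psf_lwhisker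
    psf_vcomp vassocr psf_lwhisker -vassocr).
- abstract (by move=> a b c f g h x /=; rewrite -vassocr -psf_vcomp psf_rwhisker
    psf_vcomp vassocr psf_rwhisker -vassocr).
- move=> a; apply: vcomp_inv; [exact: psf_id_inv | exact/psf_cell_inv/psf_id_inv].
- move=> a b c f g.
  apply: vcomp_inv; [exact: psf_comp_inv | exact/psf_cell_inv/psf_comp_inv].
Defined.

End CompPsfunctor.

Record pstrans_data {B C : bicat} (F G : psfunctor B C) := {
  pst_ob :> forall a : B, F a --> G a;
  pst_hom : forall {a b : B} (f : a --> b), pst_ob a · #G f ==> #F f · pst_ob b
}.

Record pstrans {B C : bicat} (F G : psfunctor B C) := {
  pst_data :> pstrans_data F G;
  pst_natural : forall (a b : B) (f g : a --> b) (x : f ==> g),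
    (pst_data a ◃ ##G x) • pst_hom pst_data g
    = pst_hom pst_data f • (##F x ▹ pst_data b);
  pst_id : forall a : B,
    (pst_data a ◃ psf_id G a) • pst_hom pst_data (id1 a)
    = (runitor (pst_data a) • linvunitor (pst_data a)) • (psf_id F a ▹ pst_data a);
  pst_comp : forall (a b c : B) (f : a --> b) (g : b --> c),
    (pst_data a ◃ psf_comp G f g) • pst_hom pst_data (f · g)
    = ((((lassociator (pst_data a) (#G f) (#G g)
          • (pst_hom pst_data f ▹ #G g))
         • rassociator (#F f) (pst_data b) (#G g))
        • (#F f ◃ pst_hom pst_data g))
       • lassociator (#F f) (#F g) (pst_data c))
      • (psf_comp F f g ▹ pst_data c);
  pst_hom_inv : forall (a b : B) (f : a --> b), is_invertible (pst_hom pst_data f)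
}.

Definition id_pstrans_data {B C : bicat} (F : psfunctor B C) : pstrans_data F F := {|
  pst_ob := fun a => id1 (F a);
  pst_hom := fun a b f => lunitor (#F f) • rinvunitor (#F f)
|}.

Section IdPstrans.
Context {B C : bicat} (F : psfunctor B C) (η := id_pstrans_data F).

Lemma vcomp_rinvunitor {a b : C} {f g : a --> b} (x : f ==> g) :
  x • rinvunitor g = rinvunitor f • (x ▹ id1 b).
Proof.
apply: (vcomp_cancel_inv_l (runitor_inv f)).
apply: (vcomp_cancel_inv_r (runitor_inv g)).
by rewrite -!vassocr rinvunitor_runitor id2_right vcomp_runitor !vassocr
  runitor_rinvunitor id2_left.
Qed.

Lemma id_pstrans_natural (a b : B) (f g : a --> b) (x : f ==> g) :
  (η a ◃ ##F x) • pst_hom η g = pst_hom η f • (##F x ▹ η b).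
Proof. by rewrite /= vassocr vcomp_lunitor -!vassocr vcomp_rinvunitor. Qed.

Lemma id_pstrans_id (a : B) :
  (η a ◃ psf_id F a) • pst_hom η (id1 a)
  = (runitor (η a) • linvunitor (η a)) • (psf_id F a ▹ η a).
Proof.
rewrite /= vassocr vcomp_lunitor -!vassocr vcomp_rinvunitor lunitor_id1_runitor.
congr vcomp; congr vcomp.
apply: (vcomp_cancel_inv_r (runitor_inv _)).
by rewrite rinvunitor_runitor -lunitor_id1_runitor linvunitor_lunitor.
Qed.

Lemma id_pstrans_comp (a b c : B) (f : a --> b) (g : b --> c) :
  (η a ◃ psf_comp F f g) • pst_hom η (f · g)
  = ((((lassociator (η a) (#F f) (#F g) • (pst_hom η f ▹ #F g))
       • rassociator (#F f) (η b) (#F g)) • (#F f ◃ pst_hom η g))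
     • lassociator (#F f) (#F g) (η c)) • (psf_comp F f g ▹ η c).
Proof.
rewrite /= vassocr vcomp_lunitor -!vassocr vcomp_rinvunitor.
rewrite -rwhisker_vcomp -lwhisker_vcomp !vassocr lunitor_triangle.
congr vcomp; rewrite -!vassocr; congr vcomp.
rewrite -runitor_rwhisker.
rewrite (vassocr (rassociator _ _ _) (_ • _)) (vassocr (rassociator _ _ _)).
rewrite rassociator_lassociator id2_left vassocr rwhisker_vcomp.
rewrite rinvunitor_runitor id2_rwhisker id2_left.
apply: (vcomp_cancel_inv_r (runitor_inv _)).
by rewrite rinvunitor_runitor -vassocr runitor_triangle lwhisker_vcomp
  rinvunitor_runitor lwhisker_id2.
Qed.

Definition id_pstrans : pstrans F F.
Proof.
exists (id_pstrans_data F).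
- exact: id_pstrans_natural.
- exact: id_pstrans_id.
- exact: id_pstrans_comp.
- move=> a b f; apply: vcomp_inv; [exact: lunitor_inv | exact: rinvunitor_inv].
Defined.

End IdPstrans.

Definition comp_pstrans_data {B C : bicat} {F G H : psfunctor B C}
  (η : pstrans_data F G) (θ : pstrans_data G H) : pstrans_data F H := {|
  pst_ob := fun a => η a · θ a;
  pst_hom := fun a b f =>
    (((rassociator (η a) (θ a) (#H f)
       • (η a ◃ pst_hom θ f))
      • lassociator (η a) (#G f) (θ b))
     • (pst_hom η f ▹ θ b))
    • rassociator (#F f) (η b) (θ b)
|}.

Section Pentagons.
Context {B : bicat}.

Lemma post {a b : B} {f g h k : a --> b} {x : f ==> g} {y : g ==> h} {w : f ==> h} :
  x • y = w -> forall z : k ==> f, (z • x) • y = z • w.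
Proof. by move=> <- z; rewrite vassocr. Qed.

Lemma postc {a b : B} {f g g' h k : a --> b}
    {x : f ==> g} {y : g ==> h} {x' : f ==> g'} {y' : g' ==> h} :
  x • y = x' • y' -> forall z : k ==> f, (z • x) • y = (z • x') • y'.
Proof. by move=> e z; rewrite -!vassocr e. Qed.

Lemma post4 {a b : B} {f1 f2 f3 f4 f5 k : a --> b} {x : f1 ==> f2} {y : f2 ==> f3}
    {u : f3 ==> f4} {v : f4 ==> f5} {w : f1 ==> f5} :
  ((x • y) • u) • v = w -> forall z : k ==> f1, (((z • x) • y) • u) • v = z • w.
Proof. by move=> <- z; rewrite !vassocr. Qed.

Context {a b c d e : B} (f : a --> b) (g : b --> c) (h : c --> d) (i : d --> e).

Lemma pentagon_lr :
  rassociator f g (h · i) • (f ◃ lassociator g h i)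
  = (lassociator (f · g) h i • (rassociator f g h ▹ i)) • rassociator f (g · h) i.
Proof.
apply: (vcomp_cancel_inv_l (lassociator_inv _ _ _)).
apply: (vcomp_cancel_inv_r (lassociator_inv _ _ _)).
apply: (vcomp_cancel_inv_r (rwhisker_inv i (lassociator_inv _ _ _))).
rewrite vassocr lassociator_rassociator id2_left lassociator_lassociator.
rewrite !vassocr (post (rassociator_lassociator _ _ _)) id2_right.
by rewrite (post (rwhisker_vcomp _ _ _)) rassociator_lassociator id2_rwhisker id2_right.
Qed.

Lemma pentagon_rr :
  rassociator f (g · h) i • (f ◃ rassociator g h i)
  = ((lassociator f g h ▹ i) • rassociator (f · g) h i) • rassociator f g (h · i).
Proof.
apply: (vcomp_cancel_inv_r (lwhisker_inv f (lassociator_inv _ _ _))).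
rewrite (post (lwhisker_vcomp _ _ _)) rassociator_lassociator lwhisker_id2 id2_right.
rewrite (post pentagon_lr) !vassocr (post (rassociator_lassociator _ _ _)) id2_right.
by rewrite rwhisker_vcomp lassociator_rassociator id2_rwhisker id2_left.
Qed.

Lemma pentagon_rl :
  ((rassociator f g (h · i) • (f ◃ lassociator g h i)) • lassociator f (g · h) i)
    • (lassociator f g h ▹ i)
  = lassociator (f · g) h i.
Proof.
rewrite pentagon_lr (post (rassociator_lassociator _ _ _)) id2_right.
by rewrite (post (rwhisker_vcomp _ _ _)) rassociator_lassociator id2_rwhisker id2_right.
Qed.

Lemma pentagon_rrr :
  ((rassociator f g h ▹ i) • rassociator f (g · h) i) • (f ◃ rassociator g h i)
  = rassociator (f · g) h i • rassociator f g (h · i).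
Proof.
rewrite (post pentagon_rr) !vassocr rwhisker_vcomp rassociator_lassociator.
by rewrite id2_rwhisker id2_left.
Qed.

Lemma pentagon_lrr :
  (rassociator f (g · h) i • (f ◃ rassociator g h i)) • lassociator f g (h · i)
  = (lassociator f g h ▹ i) • rassociator (f · g) h i.
Proof. by rewrite pentagon_rr (post (rassociator_lassociator _ _ _)) id2_right. Qed.

End Pentagons.

Lemma linvunitor_triangle {B : bicat} {a b c : B} (f : a --> b) (g : b --> c) :
  (linvunitor f ▹ g) • rassociator (id1 a) f g = linvunitor (f · g).
Proof.
apply: (vcomp_cancel_inv_r (lunitor_inv _)).
rewrite linvunitor_lunitor -lunitor_triangle vassocr.
rewrite (post (rassociator_lassociator _ _ _)) id2_right rwhisker_vcomp.
by rewrite linvunitor_lunitor id2_rwhisker.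
Qed.

Section CompPstrans.
Context {B C : bicat} {F G H : psfunctor B C} (η : pstrans F G) (θ : pstrans G H).
Let ζ := comp_pstrans_data η θ.

Lemma comp_pstrans_natural (a b : B) (f g : a --> b) (x : f ==> g) :
  (ζ a ◃ ##H x) • pst_hom ζ g = pst_hom ζ f • (##F x ▹ ζ b).
Proof.
rewrite /= !vassocr lwhisker_lwhisker_r.
rewrite (post (lwhisker_vcomp _ _ _)) pst_natural -lwhisker_vcomp !vassocr.
rewrite (post (rwhisker_lwhisker _ _ _)) !vassocr.
rewrite (post (rwhisker_vcomp _ _ _)) pst_natural -rwhisker_vcomp !vassocr.
by rewrite (post (rwhisker_rwhisker_r _ _ _)) !vassocr.
Qed.

Lemma comp_pstrans_id (a : B) :
  (ζ a ◃ psf_id H a) • pst_hom ζ (id1 a)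
  = (runitor (ζ a) • linvunitor (ζ a)) • (psf_id F a ▹ ζ a).
Proof.
rewrite /= !vassocr lwhisker_lwhisker_r.
rewrite (post (lwhisker_vcomp _ _ _)) pst_id -!lwhisker_vcomp !vassocr.
rewrite (post (rwhisker_lwhisker _ _ _)) !vassocr.
rewrite (post (rwhisker_vcomp _ _ _)) pst_id -!rwhisker_vcomp !vassocr.
rewrite (post (rwhisker_rwhisker_r _ _ _)) !vassocr.
congr vcomp.
rewrite -runitor_triangle !vassocr rassociator_lassociator id2_left.
rewrite (post (runitor_rwhisker _ _)).
rewrite (post (lwhisker_vcomp _ _ _)) linvunitor_lunitor lwhisker_id2 id2_right.
by rewrite -vassocr linvunitor_triangle.
Qed.

Lemma comp_pstrans_comp (a b c : B) (f : a --> b) (g : b --> c) :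
  (ζ a ◃ psf_comp H f g) • pst_hom ζ (f · g)
  = ((((lassociator (ζ a) (#H f) (#H g) • (pst_hom ζ f ▹ #H g))
       • rassociator (#F f) (ζ b) (#H g)) • (#F f ◃ pst_hom ζ g))
     • lassociator (#F f) (#F g) (ζ c)) • (psf_comp F f g ▹ ζ c).
Proof.
rewrite /= ?vassocr lwhisker_lwhisker_r.
rewrite (post (lwhisker_vcomp _ _ _)) pst_comp -!lwhisker_vcomp ?vassocr.
rewrite (post (rwhisker_lwhisker _ _ _)) ?vassocr.
rewrite (post (rwhisker_vcomp _ _ _)) pst_comp -!rwhisker_vcomp ?vassocr.
rewrite (post (rwhisker_rwhisker_r _ _ _)) ?vassocr.
congr vcomp.
rewrite pentagon_lr -(postc (rwhisker_lwhisker_r _ _ _)) ?vassocr.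
rewrite (post (pentagon_rr _ _ _ _)) ?vassocr -(postc (lwhisker_lwhisker_r _ _ _)) ?vassocr.
rewrite -!vassocr; do 4 congr vcomp; rewrite !vassocr.
rewrite (post4 (pentagon_rl _ _ _ _)).
rewrite (postc (rwhisker_rwhisker _ _ _)) -(postc (vcomp_whisker _ _)).
rewrite -rwhisker_rwhisker_r -!vassocr; congr vcomp; rewrite !vassocr.
rewrite pentagon_rrr -(postc (lwhisker_lwhisker_r _ _ _)).
rewrite -!vassocr; do 2 congr vcomp; rewrite !vassocr.
rewrite pentagon_lr -(postc (rwhisker_lwhisker_r _ _ _)).
by rewrite -!vassocr; do 3 congr vcomp; rewrite !vassocr pentagon_lrr.
Qed.

Definition comp_pstrans : pstrans F H.
Proof.
exists (comp_pstrans_data η θ).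
- exact: comp_pstrans_natural.
- exact: comp_pstrans_id.
- exact: comp_pstrans_comp.
- move=> a b f.
  apply: vcomp_inv; last exact: rassociator_inv.
  apply: vcomp_inv; last exact/rwhisker_inv/pst_hom_inv.
  apply: vcomp_inv; last exact: lassociator_inv.
  apply: vcomp_inv; last exact/lwhisker_inv/pst_hom_inv.
  exact: rassociator_inv.
Defined.

End CompPstrans.

Record modification {B C : bicat} {F G : psfunctor B C} (σ τ : pstrans F G) := {
  mod_cell :> forall a : B, σ a ==> τ a;
  mod_natural : forall (a b : B) (f : a --> b),
    pst_hom σ f • (#F f ◃ mod_cell b) = (mod_cell a ▹ #G f) • pst_hom τ f
}.

Record invertible_modification {B C : bicat} {F G : psfunctor B C}
    (σ τ : pstrans F G) := {
  inv_mod :> modification σ τ;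
  inv_mod_inv : forall a : B, is_invertible (inv_mod a)
}.

Record biequivalence (B C : bicat) := {
  bieq_psf :> psfunctor B C;
  bieq_inv : psfunctor C B;
  bieq_eta : pstrans (comp_psfunctor bieq_inv bieq_psf) (id_psfunctor C);
  bieq_eta_i : pstrans (id_psfunctor C) (comp_psfunctor bieq_inv bieq_psf);
  bieq_eps : pstrans (comp_psfunctor bieq_psf bieq_inv) (id_psfunctor B);
  bieq_eps_i : pstrans (id_psfunctor B) (comp_psfunctor bieq_psf bieq_inv);
  bieq_mod1 : invertible_modification (comp_pstrans bieq_eta bieq_eta_i) (id_pstrans _);
  bieq_mod2 : invertible_modification (comp_pstrans bieq_eta_i bieq_eta) (id_pstrans _);
  bieq_mod3 : invertible_modification (comp_pstrans bieq_eps bieq_eps_i) (id_pstrans _);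
  bieq_mod4 : invertible_modification (comp_pstrans bieq_eps_i bieq_eps) (id_pstrans _)
}.

Record disp_bicat_data (B : bicat) := {
  disp_ob :> B -> Type;
  disp_hom : forall {a b : B}, a --> b -> disp_ob a -> disp_ob b -> Type;
  disp_cell : forall {a b : B} {f g : a --> b} (x : f ==> g)
    {aa : disp_ob a} {bb : disp_ob b}, disp_hom f aa bb -> disp_hom g aa bb -> Type;
  disp_id1 : forall {a : B} (aa : disp_ob a), disp_hom (id1 a) aa aa;
  disp_comp1 : forall {a b c : B} {f : a --> b} {g : b --> c}
    {aa : disp_ob a} {bb : disp_ob b} {cc : disp_ob c},
    disp_hom f aa bb -> disp_hom g bb cc -> disp_hom (f · g) aa cc;
  disp_id2 : forall {a b : B} {f : a --> b} {aa : disp_ob a} {bb : disp_ob b}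
    (ff : disp_hom f aa bb), disp_cell (id2 f) ff ff;
  disp_vcomp : forall {a b : B} {f g h : a --> b} {x : f ==> g} {y : g ==> h}
    {aa : disp_ob a} {bb : disp_ob b} {ff : disp_hom f aa bb}
    {gg : disp_hom g aa bb} {hh : disp_hom h aa bb},
    disp_cell x ff gg -> disp_cell y gg hh -> disp_cell (x • y) ff hh;
  disp_lwhisker : forall {a b c : B} {f : a --> b} {g h : b --> c} {x : g ==> h}
    {aa : disp_ob a} {bb : disp_ob b} {cc : disp_ob c} (ff : disp_hom f aa bb)
    {gg : disp_hom g bb cc} {hh : disp_hom h bb cc},
    disp_cell x gg hh -> disp_cell (f ◃ x) (disp_comp1 ff gg) (disp_comp1 ff hh);
  disp_rwhisker : forall {a b c : B} {f g : a --> b} {h : b --> c} {x : f ==> g}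
    {aa : disp_ob a} {bb : disp_ob b} {cc : disp_ob c}
    {ff : disp_hom f aa bb} {gg : disp_hom g aa bb} (hh : disp_hom h bb cc),
    disp_cell x ff gg -> disp_cell (x ▹ h) (disp_comp1 ff hh) (disp_comp1 gg hh);
  disp_lunitor : forall {a b : B} {f : a --> b} {aa : disp_ob a} {bb : disp_ob b}
    (ff : disp_hom f aa bb), disp_cell (lunitor f) (disp_comp1 (disp_id1 aa) ff) ff;
  disp_linvunitor : forall {a b : B} {f : a --> b} {aa : disp_ob a} {bb : disp_ob b}
    (ff : disp_hom f aa bb), disp_cell (linvunitor f) ff (disp_comp1 (disp_id1 aa) ff);
  disp_runitor : forall {a b : B} {f : a --> b} {aa : disp_ob a} {bb : disp_ob b}
    (ff : disp_hom f aa bb), disp_cell (runitor f) (disp_comp1 ff (disp_id1 bb)) ff;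
  disp_rinvunitor : forall {a b : B} {f : a --> b} {aa : disp_ob a} {bb : disp_ob b}
    (ff : disp_hom f aa bb), disp_cell (rinvunitor f) ff (disp_comp1 ff (disp_id1 bb));
  disp_lassociator : forall {a b c d : B} {f : a --> b} {g : b --> c} {h : c --> d}
    {aa : disp_ob a} {bb : disp_ob b} {cc : disp_ob c} {dd : disp_ob d}
    (ff : disp_hom f aa bb) (gg : disp_hom g bb cc) (hh : disp_hom h cc dd),
    disp_cell (lassociator f g h)
      (disp_comp1 ff (disp_comp1 gg hh)) (disp_comp1 (disp_comp1 ff gg) hh);
  disp_rassociator : forall {a b c d : B} {f : a --> b} {g : b --> c} {h : c --> d}
    {aa : disp_ob a} {bb : disp_ob b} {cc : disp_ob c} {dd : disp_ob d}
    (ff : disp_hom f aa bb) (gg : disp_hom g bb cc) (hh : disp_hom h cc dd),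
    disp_cell (rassociator f g h)
      (disp_comp1 (disp_comp1 ff gg) hh) (disp_comp1 ff (disp_comp1 gg hh))
}.

Arguments disp_hom {B d a b} f aa bb : rename.
Arguments disp_cell {B d a b f g} x {aa bb} ff gg : rename.
Arguments disp_id1 {B d a} aa : rename.

Reserved Notation "aa -->[ f ] bb"
  (at level 55, f at level 60, no associativity, format "aa  -->[ f ]  bb").
Reserved Notation "ff ==>[ x ] gg"
  (at level 60, x at level 60, no associativity, format "ff  ==>[ x ]  gg").
Reserved Notation "ff ·· gg" (at level 40, left associativity).
Reserved Notation "xx •• yy" (at level 50, left associativity).
Reserved Notation "ff ◃◃ xx" (at level 45, no associativity).
Reserved Notation "xx ▹▹ ff" (at level 45, no associativity).

Notation "aa -->[ f ] bb" := (disp_hom f aa bb) : bicat_scope.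
Notation "ff ==>[ x ] gg" := (disp_cell x ff gg) : bicat_scope.
Notation "ff ·· gg" := (disp_comp1 ff gg) : bicat_scope.
Notation "xx •• yy" := (disp_vcomp xx yy) : bicat_scope.
Notation "ff ◃◃ xx" := (disp_lwhisker ff xx) : bicat_scope.
Notation "xx ▹▹ ff" := (disp_rwhisker ff xx) : bicat_scope.

Definition eq_over {B : bicat} {D : disp_bicat_data B} {a b : B} {f g : a --> b}
    {x y : f ==> g} (p : x = y) {aa : D a} {bb : D b}
    {ff : aa -->[f] bb} {gg : aa -->[g] bb}
    (xx : ff ==>[x] gg) (yy : ff ==>[y] gg) : Prop :=
  rew [fun z => ff ==>[z] gg] p in xx = yy.

Notation "xx =[ p ] yy" := (eq_over p xx yy)
  (at level 70, p at level 60, no associativity, format "xx  =[ p ]  yy") : bicat_scope.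

Record disp_bicat (B : bicat) := {
  disp_ops :> disp_bicat_data B;
  disp_id2_left : forall (a b : B) (f g : a --> b) (x : f ==> g)
      (aa : disp_ops a) (bb : disp_ops b) (ff : aa -->[f] bb) (gg : aa -->[g] bb)
      (xx : ff ==>[x] gg),
    disp_id2 ff •• xx =[id2_left x] xx;
  disp_id2_right : forall (a b : B) (f g : a --> b) (x : f ==> g)
      (aa : disp_ops a) (bb : disp_ops b) (ff : aa -->[f] bb) (gg : aa -->[g] bb)
      (xx : ff ==>[x] gg),
    xx •• disp_id2 gg =[id2_right x] xx;
  disp_vassocr : forall (a b : B) (f g h k : a --> b)
      (x : f ==> g) (y : g ==> h) (z : h ==> k) (aa : disp_ops a) (bb : disp_ops b)
      (ff : aa -->[f] bb) (gg : aa -->[g] bb) (hh : aa -->[h] bb) (kk : aa -->[k] bb)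
      (xx : ff ==>[x] gg) (yy : gg ==>[y] hh) (zz : hh ==>[z] kk),
    xx •• (yy •• zz) =[vassocr x y z] (xx •• yy) •• zz;
  disp_lwhisker_id2 : forall (a b c : B) (f : a --> b) (g : b --> c)
      (aa : disp_ops a) (bb : disp_ops b) (cc : disp_ops c)
      (ff : aa -->[f] bb) (gg : bb -->[g] cc),
    ff ◃◃ disp_id2 gg =[lwhisker_id2 f g] disp_id2 (ff ·· gg);
  disp_id2_rwhisker : forall (a b c : B) (f : a --> b) (g : b --> c)
      (aa : disp_ops a) (bb : disp_ops b) (cc : disp_ops c)
      (ff : aa -->[f] bb) (gg : bb -->[g] cc),
    disp_id2 ff ▹▹ gg =[id2_rwhisker f g] disp_id2 (ff ·· gg);
  disp_lwhisker_vcomp : forall (a b c : B) (f : a --> b) (g h k : b --> c)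
      (x : g ==> h) (y : h ==> k) (aa : disp_ops a) (bb : disp_ops b) (cc : disp_ops c)
      (ff : aa -->[f] bb) (gg : bb -->[g] cc) (hh : bb -->[h] cc) (kk : bb -->[k] cc)
      (xx : gg ==>[x] hh) (yy : hh ==>[y] kk),
    (ff ◃◃ xx) •• (ff ◃◃ yy) =[lwhisker_vcomp f x y] ff ◃◃ (xx •• yy);
  disp_rwhisker_vcomp : forall (a b c : B) (f g h : a --> b) (k : b --> c)
      (x : f ==> g) (y : g ==> h) (aa : disp_ops a) (bb : disp_ops b) (cc : disp_ops c)
      (ff : aa -->[f] bb) (gg : aa -->[g] bb) (hh : aa -->[h] bb) (kk : bb -->[k] cc)
      (xx : ff ==>[x] gg) (yy : gg ==>[y] hh),
    (xx ▹▹ kk) •• (yy ▹▹ kk) =[rwhisker_vcomp k x y] (xx •• yy) ▹▹ kk;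
  disp_vcomp_lunitor : forall (a b : B) (f g : a --> b) (x : f ==> g)
      (aa : disp_ops a) (bb : disp_ops b) (ff : aa -->[f] bb) (gg : aa -->[g] bb)
      (xx : ff ==>[x] gg),
    (disp_id1 aa ◃◃ xx) •• disp_lunitor gg =[vcomp_lunitor x] disp_lunitor ff •• xx;
  disp_vcomp_runitor : forall (a b : B) (f g : a --> b) (x : f ==> g)
      (aa : disp_ops a) (bb : disp_ops b) (ff : aa -->[f] bb) (gg : aa -->[g] bb)
      (xx : ff ==>[x] gg),
    (xx ▹▹ disp_id1 bb) •• disp_runitor gg =[vcomp_runitor x] disp_runitor ff •• xx;
  disp_lwhisker_lwhisker : forall (a b c d : B) (f : a --> b) (g : b --> c)
      (h i : c --> d) (x : h ==> i)
      (aa : disp_ops a) (bb : disp_ops b) (cc : disp_ops c) (dd : disp_ops d)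
      (ff : aa -->[f] bb) (gg : bb -->[g] cc) (hh : cc -->[h] dd) (ii : cc -->[i] dd)
      (xx : hh ==>[x] ii),
    (ff ◃◃ (gg ◃◃ xx)) •• disp_lassociator ff gg ii
    =[lwhisker_lwhisker f g x] disp_lassociator ff gg hh •• (ff ·· gg ◃◃ xx);
  disp_rwhisker_lwhisker : forall (a b c d : B) (f : a --> b) (g h : b --> c)
      (i : c --> d) (x : g ==> h)
      (aa : disp_ops a) (bb : disp_ops b) (cc : disp_ops c) (dd : disp_ops d)
      (ff : aa -->[f] bb) (gg : bb -->[g] cc) (hh : bb -->[h] cc) (ii : cc -->[i] dd)
      (xx : gg ==>[x] hh),
    (ff ◃◃ (xx ▹▹ ii)) •• disp_lassociator ff hh ii
    =[rwhisker_lwhisker f i x] disp_lassociator ff gg ii •• ((ff ◃◃ xx) ▹▹ ii);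
  disp_rwhisker_rwhisker : forall (a b c d : B) (f g : a --> b) (h : b --> c)
      (i : c --> d) (x : f ==> g)
      (aa : disp_ops a) (bb : disp_ops b) (cc : disp_ops c) (dd : disp_ops d)
      (ff : aa -->[f] bb) (gg : aa -->[g] bb) (hh : bb -->[h] cc) (ii : cc -->[i] dd)
      (xx : ff ==>[x] gg),
    disp_lassociator ff hh ii •• ((xx ▹▹ hh) ▹▹ ii)
    =[rwhisker_rwhisker h i x] (xx ▹▹ hh ·· ii) •• disp_lassociator gg hh ii;
  disp_vcomp_whisker : forall (a b c : B) (f g : a --> b) (h i : b --> c)
      (x : f ==> g) (y : h ==> i) (aa : disp_ops a) (bb : disp_ops b) (cc : disp_ops c)
      (ff : aa -->[f] bb) (gg : aa -->[g] bb) (hh : bb -->[h] cc) (ii : bb -->[i] cc)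
      (xx : ff ==>[x] gg) (yy : hh ==>[y] ii),
    (xx ▹▹ hh) •• (gg ◃◃ yy) =[vcomp_whisker x y] (ff ◃◃ yy) •• (xx ▹▹ ii);
  disp_lunitor_linvunitor : forall (a b : B) (f : a --> b)
      (aa : disp_ops a) (bb : disp_ops b) (ff : aa -->[f] bb),
    disp_lunitor ff •• disp_linvunitor ff
    =[lunitor_linvunitor f] disp_id2 (disp_id1 aa ·· ff);
  disp_linvunitor_lunitor : forall (a b : B) (f : a --> b)
      (aa : disp_ops a) (bb : disp_ops b) (ff : aa -->[f] bb),
    disp_linvunitor ff •• disp_lunitor ff =[linvunitor_lunitor f] disp_id2 ff;
  disp_runitor_rinvunitor : forall (a b : B) (f : a --> b)
      (aa : disp_ops a) (bb : disp_ops b) (ff : aa -->[f] bb),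
    disp_runitor ff •• disp_rinvunitor ff
    =[runitor_rinvunitor f] disp_id2 (ff ·· disp_id1 bb);
  disp_rinvunitor_runitor : forall (a b : B) (f : a --> b)
      (aa : disp_ops a) (bb : disp_ops b) (ff : aa -->[f] bb),
    disp_rinvunitor ff •• disp_runitor ff =[rinvunitor_runitor f] disp_id2 ff;
  disp_lassociator_rassociator : forall (a b c d : B)
      (f : a --> b) (g : b --> c) (h : c --> d)
      (aa : disp_ops a) (bb : disp_ops b) (cc : disp_ops c) (dd : disp_ops d)
      (ff : aa -->[f] bb) (gg : bb -->[g] cc) (hh : cc -->[h] dd),
    disp_lassociator ff gg hh •• disp_rassociator ff gg hh
    =[lassociator_rassociator f g h] disp_id2 (ff ·· (gg ·· hh));
  disp_rassociator_lassociator : forall (a b c d : B)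
      (f : a --> b) (g : b --> c) (h : c --> d)
      (aa : disp_ops a) (bb : disp_ops b) (cc : disp_ops c) (dd : disp_ops d)
      (ff : aa -->[f] bb) (gg : bb -->[g] cc) (hh : cc -->[h] dd),
    disp_rassociator ff gg hh •• disp_lassociator ff gg hh
    =[rassociator_lassociator f g h] disp_id2 ((ff ·· gg) ·· hh);
  disp_runitor_rwhisker : forall (a b c : B) (f : a --> b) (g : b --> c)
      (aa : disp_ops a) (bb : disp_ops b) (cc : disp_ops c)
      (ff : aa -->[f] bb) (gg : bb -->[g] cc),
    disp_lassociator ff (disp_id1 bb) gg •• (disp_runitor ff ▹▹ gg)
    =[runitor_rwhisker f g] ff ◃◃ disp_lunitor gg;
  disp_lassociator_lassociator : forall (a b c d e : B)
      (f : a --> b) (g : b --> c) (h : c --> d) (i : d --> e)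
      (aa : disp_ops a) (bb : disp_ops b) (cc : disp_ops c) (dd : disp_ops d)
      (ee : disp_ops e) (ff : aa -->[f] bb) (gg : bb -->[g] cc) (hh : cc -->[h] dd)
      (ii : dd -->[i] ee),
    ((ff ◃◃ disp_lassociator gg hh ii) •• disp_lassociator ff (gg ·· hh) ii)
      •• (disp_lassociator ff gg hh ▹▹ ii)
    =[lassociator_lassociator f g h i]
    disp_lassociator ff gg (hh ·· ii) •• disp_lassociator (ff ·· gg) hh ii;
  disp_cell_set : forall (a b : B) (f g : a --> b) (x : f ==> g)
      (aa : disp_ops a) (bb : disp_ops b) (ff : aa -->[f] bb) (gg : aa -->[g] bb),
    UIP_ (ff ==>[x] gg)
}.

Record is_disp_invertible {B : bicat} {D : disp_bicat B} {a b : B} {f g : a --> b}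
    {x : f ==> g} (ix : is_invertible x) {aa : D a} {bb : D b}
    {ff : aa -->[f] bb} {gg : aa -->[g] bb} (xx : ff ==>[x] gg) := {
  disp_inv_cell : gg ==>[inv_cell ix] ff;
  disp_inv_cell_right : xx •• disp_inv_cell =[inv_cell_right ix] disp_id2 ff;
  disp_inv_cell_left : disp_inv_cell •• xx =[inv_cell_left ix] disp_id2 gg
}.

Lemma eq_over_total {B : bicat} {D : disp_bicat_data B} {a b : B} {f g : a --> b}
    {x y : f ==> g} (p : x = y) {aa : D a} {bb : D b}
    {ff : aa -->[f] bb} {gg : aa -->[g] bb} (xx : ff ==>[x] gg) (yy : ff ==>[y] gg) :
  xx =[p] yy ->
  existT (fun z => ff ==>[z] gg) x xx = existT (fun z => ff ==>[z] gg) y yy.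
Proof. by case: y / p yy => yy <-. Qed.

Lemma total_eq_over {B : bicat} {D : disp_bicat_data B} {a b : B} {f g : a --> b}
    {x y : f ==> g} (p : x = y) {aa : D a} {bb : D b}
    {ff : aa -->[f] bb} {gg : aa -->[g] bb} (xx : ff ==>[x] gg) (yy : ff ==>[y] gg) :
  existT (fun z => ff ==>[z] gg) x xx = existT (fun z => ff ==>[z] gg) y yy ->
  xx =[p] yy.
Proof.
move=> e; rewrite /eq_over (cell_set p (projT1_eq e)); exact: (projT2_eq e).
Qed.

Lemma UIP_sigT {A : Type} {P : A -> Type} :
  UIP_ A -> (forall a, UIP_ (P a)) -> UIP_ {a : A & P a}.
Proof.
move=> uA uP u v.
have E (r : u = v) : r = eq_sigT u v (projT1_eq r) (projT2_eq r).
  by case: v / r; case: u.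
move=> p q; rewrite (E p) (E q).
move: (projT1_eq p) (projT2_eq p) (projT1_eq q) (projT2_eq q) => p1 p2 q1.
by case: q1 / (uA _ _ p1 q1) => q2; rewrite (uP _ _ _ p2 q2).
Qed.

Definition total_bicat_data {B : bicat} (D : disp_bicat_data B) : bicat_data := {|
  ob := {a : B & D a};
  hom := fun a b => {f : projT1 a --> projT1 b & projT2 a -->[f] projT2 b};
  cell := fun a b f g => {x : projT1 f ==> projT1 g & projT2 f ==>[x] projT2 g};
  id1 := fun a => existT _ (id1 (projT1 a)) (disp_id1 (projT2 a));
  comp1 := fun a b c f g => existT _ (projT1 f · projT1 g) (projT2 f ·· projT2 g);
  id2 := fun a b f => existT _ (id2 (projT1 f)) (disp_id2 (projT2 f));
  vcomp := fun a b f g h x y => existT _ (projT1 x • projT1 y) (projT2 x •• projT2 y);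
  lwhisker := fun a b c f g h x =>
    existT _ (projT1 f ◃ projT1 x) (projT2 f ◃◃ projT2 x);
  rwhisker := fun a b c f g h x =>
    existT _ (projT1 x ▹ projT1 h) (projT2 x ▹▹ projT2 h);
  lunitor := fun a b f => existT _ (lunitor (projT1 f)) (disp_lunitor (projT2 f));
  linvunitor := fun a b f => existT _ (linvunitor (projT1 f)) (disp_linvunitor (projT2 f));
  runitor := fun a b f => existT _ (runitor (projT1 f)) (disp_runitor (projT2 f));
  rinvunitor := fun a b f => existT _ (rinvunitor (projT1 f)) (disp_rinvunitor (projT2 f));
  lassociator := fun a b c d f g h =>
    existT _ (lassociator (projT1 f) (projT1 g) (projT1 h))
      (disp_lassociator (projT2 f) (projT2 g) (projT2 h));
  rassociator := fun a b c d f g h =>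
    existT _ (rassociator (projT1 f) (projT1 g) (projT1 h))
      (disp_rassociator (projT2 f) (projT2 g) (projT2 h))
|}.

Definition total_bicat {B : bicat} (D : disp_bicat B) : bicat.
Proof.
exists (total_bicat_data D).
- abstract (by move=> a b f g [x xx]; exact: eq_over_total (disp_id2_left xx)).
- abstract (by move=> a b f g [x xx]; exact: eq_over_total (disp_id2_right xx)).
- abstract (by move=> *; exact: eq_over_total (disp_vassocr _ _ _)).
- abstract (by move=> *; exact: eq_over_total (disp_lwhisker_id2 _ _)).
- abstract (by move=> *; exact: eq_over_total (disp_id2_rwhisker _ _)).
- abstract (by move=> *; exact: eq_over_total (disp_lwhisker_vcomp _ _ _)).
- abstract (by move=> *; exact: eq_over_total (disp_rwhisker_vcomp _ _ _)).
- abstract (by move=> *; exact: eq_over_total (disp_vcomp_lunitor _)).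
- abstract (by move=> *; exact: eq_over_total (disp_vcomp_runitor _)).
- abstract (by move=> *; exact: eq_over_total (disp_lwhisker_lwhisker _ _ _)).
- abstract (by move=> *; exact: eq_over_total (disp_rwhisker_lwhisker _ _ _)).
- abstract (by move=> *; exact: eq_over_total (disp_rwhisker_rwhisker _ _ _)).
- abstract (by move=> *; exact: eq_over_total (disp_vcomp_whisker _ _)).
- abstract (by move=> *; exact: eq_over_total (disp_lunitor_linvunitor _)).
- abstract (by move=> *; exact: eq_over_total (disp_linvunitor_lunitor _)).
- abstract (by move=> *; exact: eq_over_total (disp_runitor_rinvunitor _)).
- abstract (by move=> *; exact: eq_over_total (disp_rinvunitor_runitor _)).
- abstract (by move=> *; exact: eq_over_total (disp_lassociator_rassociator _ _ _)).
- abstract (by move=> *; exact: eq_over_total (disp_rassociator_lassociator _ _ _)).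
- abstract (by move=> *; exact: eq_over_total (disp_runitor_rwhisker _ _)).
- abstract (by move=> *; exact: eq_over_total (disp_lassociator_lassociator _ _ _ _)).
- abstract (by move=> a b f g; apply: UIP_sigT;
    [exact: cell_set | move=> x; exact: disp_cell_set]).
Defined.

Notation "∫ D" := (total_bicat D) (at level 3, D at level 2, format "∫ D") : bicat_scope.

Section TotalCells.
Context {B : bicat} {D : disp_bicat B}.

Definition total_ob {a : B} (aa : D a) : ∫D := existT _ a aa.

Definition total_hom {a b : B} {f : a --> b} {aa : D a} {bb : D b}
  (ff : aa -->[f] bb) : total_ob aa --> total_ob bb := existT _ f ff.

Definition total_cell {a b : B} {f g : a --> b} {x : f ==> g} {aa : D a} {bb : D b}
  {ff : aa -->[f] bb} {gg : aa -->[g] bb} (xx : ff ==>[x] gg) :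
  total_hom ff ==> total_hom gg := existT _ x xx.

Definition total_is_invertible {a b : B} {f g : a --> b} {x : f ==> g}
  {ix : is_invertible x} {aa : D a} {bb : D b} {ff : aa -->[f] bb} {gg : aa -->[g] bb}
  {xx : ff ==>[x] gg} (ixx : is_disp_invertible ix xx) :
  is_invertible (total_cell xx) :=
  @Build_is_invertible (∫D) _ _ _ _ (total_cell xx) (total_cell (disp_inv_cell ixx))
    (eq_over_total (disp_inv_cell_right ixx)) (eq_over_total (disp_inv_cell_left ixx)).

Definition disp_is_invertible {a b : B} {f g : a --> b} {x : f ==> g}
  (ix : is_invertible x) {aa : D a} {bb : D b} {ff : aa -->[f] bb} {gg : aa -->[g] bb}
  {xx : ff ==>[x] gg} (yy : gg ==>[inv_cell ix] ff)
  (t : is_invertible (total_cell xx)) :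
  inv_cell t = total_cell yy -> is_disp_invertible ix xx.
Proof.
move=> e; exists yy.
- abstract (apply: total_eq_over; move: (inv_cell_right t); rewrite e; exact).
- abstract (apply: total_eq_over; move: (inv_cell_left t); rewrite e; exact).
Defined.

End TotalCells.

Record disp_psfunctor_data {B C : bicat} (D1 : disp_bicat B) (D2 : disp_bicat C)
    (F : psfunctor B C) := {
  dpsf_ob :> forall {a : B}, D1 a -> D2 (F a);
  dpsf_hom : forall {a b : B} {f : a --> b} {aa : D1 a} {bb : D1 b},
    aa -->[f] bb -> dpsf_ob aa -->[#F f] dpsf_ob bb;
  dpsf_cell : forall {a b : B} {f g : a --> b} {x : f ==> g} {aa : D1 a} {bb : D1 b}
    {ff : aa -->[f] bb} {gg : aa -->[g] bb},
    ff ==>[x] gg -> dpsf_hom ff ==>[##F x] dpsf_hom gg;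
  dpsf_id : forall {a : B} (aa : D1 a),
    disp_id1 (dpsf_ob aa) ==>[psf_id F a] dpsf_hom (disp_id1 aa);
  dpsf_comp : forall {a b c : B} {f : a --> b} {g : b --> c}
    {aa : D1 a} {bb : D1 b} {cc : D1 c} (ff : aa -->[f] bb) (gg : bb -->[g] cc),
    dpsf_hom ff ·· dpsf_hom gg ==>[psf_comp F f g] dpsf_hom (ff ·· gg)
}.

Record disp_psfunctor {B C : bicat} (D1 : disp_bicat B) (D2 : disp_bicat C)
    (F : psfunctor B C) := {
  dpsf_data :> disp_psfunctor_data D1 D2 F;
  dpsf_id2 : forall (a b : B) (f : a --> b) (aa : D1 a) (bb : D1 b) (ff : aa -->[f] bb),
    dpsf_cell dpsf_data (disp_id2 ff) =[psf_id2 F f] disp_id2 (dpsf_hom dpsf_data ff);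
  dpsf_vcomp : forall (a b : B) (f g h : a --> b) (x : f ==> g) (y : g ==> h)
      (aa : D1 a) (bb : D1 b) (ff : aa -->[f] bb) (gg : aa -->[g] bb) (hh : aa -->[h] bb)
      (xx : ff ==>[x] gg) (yy : gg ==>[y] hh),
    dpsf_cell dpsf_data (xx •• yy)
    =[psf_vcomp F x y] dpsf_cell dpsf_data xx •• dpsf_cell dpsf_data yy;
  dpsf_lunitor : forall (a b : B) (f : a --> b) (aa : D1 a) (bb : D1 b)
      (ff : aa -->[f] bb),
    disp_lunitor (dpsf_hom dpsf_data ff)
    =[psf_lunitor F f]
    ((dpsf_id dpsf_data aa ▹▹ dpsf_hom dpsf_data ff)
     •• dpsf_comp dpsf_data (disp_id1 aa) ff)
      •• dpsf_cell dpsf_data (disp_lunitor ff);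
  dpsf_runitor : forall (a b : B) (f : a --> b) (aa : D1 a) (bb : D1 b)
      (ff : aa -->[f] bb),
    disp_runitor (dpsf_hom dpsf_data ff)
    =[psf_runitor F f]
    ((dpsf_hom dpsf_data ff ◃◃ dpsf_id dpsf_data bb)
     •• dpsf_comp dpsf_data ff (disp_id1 bb))
      •• dpsf_cell dpsf_data (disp_runitor ff);
  dpsf_lassociator : forall (a b c d : B) (f : a --> b) (g : b --> c) (h : c --> d)
      (aa : D1 a) (bb : D1 b) (cc : D1 c) (dd : D1 d)
      (ff : aa -->[f] bb) (gg : bb -->[g] cc) (hh : cc -->[h] dd),
    ((dpsf_hom dpsf_data ff ◃◃ dpsf_comp dpsf_data gg hh)
     •• dpsf_comp dpsf_data ff (gg ·· hh))
      •• dpsf_cell dpsf_data (disp_lassociator ff gg hh)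
    =[psf_lassociator F f g h]
    (disp_lassociator (dpsf_hom dpsf_data ff) (dpsf_hom dpsf_data gg)
       (dpsf_hom dpsf_data hh)
     •• (dpsf_comp dpsf_data ff gg ▹▹ dpsf_hom dpsf_data hh))
      •• dpsf_comp dpsf_data (ff ·· gg) hh;
  dpsf_lwhisker : forall (a b c : B) (f : a --> b) (g h : b --> c) (x : g ==> h)
      (aa : D1 a) (bb : D1 b) (cc : D1 c)
      (ff : aa -->[f] bb) (gg : bb -->[g] cc) (hh : bb -->[h] cc) (xx : gg ==>[x] hh),
    dpsf_comp dpsf_data ff gg •• dpsf_cell dpsf_data (ff ◃◃ xx)
    =[psf_lwhisker F f x]
    (dpsf_hom dpsf_data ff ◃◃ dpsf_cell dpsf_data xx) •• dpsf_comp dpsf_data ff hh;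
  dpsf_rwhisker : forall (a b c : B) (f g : a --> b) (h : b --> c) (x : f ==> g)
      (aa : D1 a) (bb : D1 b) (cc : D1 c)
      (ff : aa -->[f] bb) (gg : aa -->[g] bb) (hh : bb -->[h] cc) (xx : ff ==>[x] gg),
    dpsf_comp dpsf_data ff hh •• dpsf_cell dpsf_data (xx ▹▹ hh)
    =[psf_rwhisker F h x]
    (dpsf_cell dpsf_data xx ▹▹ dpsf_hom dpsf_data hh) •• dpsf_comp dpsf_data gg hh;
  dpsf_id_inv : forall (a : B) (aa : D1 a),
    is_disp_invertible (psf_id_inv F a) (dpsf_id dpsf_data aa);
  dpsf_comp_inv : forall (a b c : B) (f : a --> b) (g : b --> c)
      (aa : D1 a) (bb : D1 b) (cc : D1 c) (ff : aa -->[f] bb) (gg : bb -->[g] cc),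
    is_disp_invertible (psf_comp_inv F f g) (dpsf_comp dpsf_data ff gg)
}.

Definition total_psfunctor_data {B C : bicat} {D1 : disp_bicat B} {D2 : disp_bicat C}
  {F : psfunctor B C} (FF : disp_psfunctor_data D1 D2 F) :
  psfunctor_data (∫D1) (∫D2) :=
  @Build_psfunctor_data (∫D1) (∫D2)
    (fun a => existT _ (F (projT1 a)) (FF _ (projT2 a)))
    (fun a b f => existT _ (#F (projT1 f)) (dpsf_hom FF (projT2 f)))
    (fun a b f g x => existT _ (##F (projT1 x)) (dpsf_cell FF (projT2 x)))
    (fun a => existT _ (psf_id F (projT1 a)) (dpsf_id FF (projT2 a)))
    (fun a b c f g =>
      existT _ (psf_comp F (projT1 f) (projT1 g)) (dpsf_comp FF (projT2 f) (projT2 g))).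

Definition total_psfunctor {B C : bicat} {D1 : disp_bicat B} {D2 : disp_bicat C}
  {F : psfunctor B C} (FF : disp_psfunctor D1 D2 F) : psfunctor (∫D1) (∫D2).
Proof.
exists (total_psfunctor_data FF).
- abstract (by move=> *; exact: eq_over_total (dpsf_id2 _ _)).
- abstract (by move=> *; exact: eq_over_total (dpsf_vcomp _ _ _)).
- abstract (by move=> *; exact: eq_over_total (dpsf_lunitor _ _)).
- abstract (by move=> *; exact: eq_over_total (dpsf_runitor _ _)).
- abstract (by move=> *; exact: eq_over_total (dpsf_lassociator _ _ _ _)).
- abstract (by move=> *; exact: eq_over_total (dpsf_lwhisker _ _ _)).
- abstract (by move=> *; exact: eq_over_total (dpsf_rwhisker _ _ _)).
- move=> a; exact: total_is_invertible (dpsf_id_inv FF (projT2 a)).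
- move=> a b c f g.
  exact: total_is_invertible (dpsf_comp_inv FF (projT2 f) (projT2 g)).
Defined.

Section DispInvertible.
Context {B : bicat} {D : disp_bicat B}.

Definition disp_id2_inv {a b : B} {f : a --> b} {aa : D a} {bb : D b}
  (ff : aa -->[f] bb) : is_disp_invertible (id2_inv f) (disp_id2 ff) :=
  disp_is_invertible (ix := id2_inv f) (yy := disp_id2 ff)
    (t := id2_inv (total_hom ff)) eq_refl.

Definition disp_vcomp_inv {a b : B} {f g h : a --> b} {x : f ==> g} {y : g ==> h}
  {ix : is_invertible x} {iy : is_invertible y} {aa : D a} {bb : D b}
  {ff : aa -->[f] bb} {gg : aa -->[g] bb} {hh : aa -->[h] bb}
  {xx : ff ==>[x] gg} {yy : gg ==>[y] hh}
  (ixx : is_disp_invertible ix xx) (iyy : is_disp_invertible iy yy) :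
  is_disp_invertible (vcomp_inv ix iy) (xx •• yy) :=
  disp_is_invertible (ix := vcomp_inv ix iy)
    (yy := disp_inv_cell iyy •• disp_inv_cell ixx)
    (t := vcomp_inv (total_is_invertible ixx) (total_is_invertible iyy)) eq_refl.

Definition disp_lwhisker_inv {a b c : B} {f : a --> b} {g h : b --> c} {x : g ==> h}
  {ix : is_invertible x} {aa : D a} {bb : D b} {cc : D c} (ff : aa -->[f] bb)
  {gg : bb -->[g] cc} {hh : bb -->[h] cc} {xx : gg ==>[x] hh}
  (ixx : is_disp_invertible ix xx) :
  is_disp_invertible (lwhisker_inv f ix) (ff ◃◃ xx) :=
  disp_is_invertible (ix := lwhisker_inv f ix) (yy := ff ◃◃ disp_inv_cell ixx)
    (t := lwhisker_inv (total_hom ff) (total_is_invertible ixx)) eq_refl.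

Definition disp_rwhisker_inv {a b c : B} {f g : a --> b} {h : b --> c} {x : f ==> g}
  {ix : is_invertible x} {aa : D a} {bb : D b} {cc : D c}
  {ff : aa -->[f] bb} {gg : aa -->[g] bb} (hh : bb -->[h] cc) {xx : ff ==>[x] gg}
  (ixx : is_disp_invertible ix xx) :
  is_disp_invertible (rwhisker_inv h ix) (xx ▹▹ hh) :=
  disp_is_invertible (ix := rwhisker_inv h ix) (yy := disp_inv_cell ixx ▹▹ hh)
    (t := rwhisker_inv (total_hom hh) (total_is_invertible ixx)) eq_refl.

Definition disp_lunitor_inv {a b : B} {f : a --> b} {aa : D a} {bb : D b}
  (ff : aa -->[f] bb) : is_disp_invertible (lunitor_inv f) (disp_lunitor ff) :=
  @Build_is_disp_invertible _ _ _ _ _ _ _ (lunitor_inv f) _ _ _ _ _ _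
    (disp_lunitor_linvunitor ff) (disp_linvunitor_lunitor ff).

Definition disp_rinvunitor_inv {a b : B} {f : a --> b} {aa : D a} {bb : D b}
  (ff : aa -->[f] bb) : is_disp_invertible (rinvunitor_inv f) (disp_rinvunitor ff) :=
  @Build_is_disp_invertible _ _ _ _ _ _ _ (rinvunitor_inv f) _ _ _ _ _ _
    (disp_rinvunitor_runitor ff) (disp_runitor_rinvunitor ff).

Definition disp_lassociator_inv {a b c d : B} {f : a --> b} {g : b --> c} {h : c --> d}
  {aa : D a} {bb : D b} {cc : D c} {dd : D d}
  (ff : aa -->[f] bb) (gg : bb -->[g] cc) (hh : cc -->[h] dd) :
  is_disp_invertible (lassociator_inv f g h) (disp_lassociator ff gg hh) :=
  @Build_is_disp_invertible _ _ _ _ _ _ _ (lassociator_inv f g h) _ _ _ _ _ _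
    (disp_lassociator_rassociator ff gg hh) (disp_rassociator_lassociator ff gg hh).

Definition disp_rassociator_inv {a b c d : B} {f : a --> b} {g : b --> c} {h : c --> d}
  {aa : D a} {bb : D b} {cc : D c} {dd : D d}
  (ff : aa -->[f] bb) (gg : bb -->[g] cc) (hh : cc -->[h] dd) :
  is_disp_invertible (rassociator_inv f g h) (disp_rassociator ff gg hh) :=
  @Build_is_disp_invertible _ _ _ _ _ _ _ (rassociator_inv f g h) _ _ _ _ _ _
    (disp_rassociator_lassociator ff gg hh) (disp_lassociator_rassociator ff gg hh).

End DispInvertible.

Definition dpsf_cell_inv {B C : bicat} {D1 : disp_bicat B} {D2 : disp_bicat C}
  {F : psfunctor B C} (FF : disp_psfunctor D1 D2 F)
  {a b : B} {f g : a --> b} {x : f ==> g} {ix : is_invertible x} {aa : D1 a} {bb : D1 b}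
  {ff : aa -->[f] bb} {gg : aa -->[g] bb} {xx : ff ==>[x] gg}
  (ixx : is_disp_invertible ix xx) :
  is_disp_invertible (psf_cell_inv F ix) (dpsf_cell FF xx) :=
  disp_is_invertible (ix := psf_cell_inv F ix) (yy := dpsf_cell FF (disp_inv_cell ixx))
    (t := psf_cell_inv (total_psfunctor FF) (total_is_invertible ixx)) eq_refl.

Definition disp_id_psfunctor_data {B : bicat} (D : disp_bicat B) :
  disp_psfunctor_data D D (id_psfunctor B) :=
  @Build_disp_psfunctor_data B B D D (id_psfunctor B)
    (fun a aa => aa)
    (fun a b f aa bb ff => ff)
    (fun a b f g x aa bb ff gg xx => xx)
    (fun a aa => disp_id2 (disp_id1 aa))
    (fun a b c f g aa bb cc ff gg => disp_id2 (ff ·· gg)).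

(* The laws of the displayed identities and composites are read off from those of
   the identities and composites of the corresponding total cells. *)
Definition disp_id_psfunctor {B : bicat} (D : disp_bicat B) :
  disp_psfunctor D D (id_psfunctor B).
Proof.
pose I := id_psfunctor (∫D).
exists (disp_id_psfunctor_data D).
- abstract (move=> a b f aa bb ff; apply: total_eq_over;
    exact: (psf_id2 I (total_hom ff))).
- abstract (move=> a b f g h x y aa bb ff gg hh xx yy; apply: total_eq_over;
    exact: (psf_vcomp I (total_cell xx) (total_cell yy))).
- abstract (move=> a b f aa bb ff; apply: total_eq_over;
    exact: (psf_lunitor I (total_hom ff))).
- abstract (move=> a b f aa bb ff; apply: total_eq_over;
    exact: (psf_runitor I (total_hom ff))).
- abstract (move=> a b c d f g h aa bb cc dd ff gg hh; apply: total_eq_over;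
    exact: (psf_lassociator I (total_hom ff) (total_hom gg) (total_hom hh))).
- abstract (move=> a b c f g h x aa bb cc ff gg hh xx; apply: total_eq_over;
    exact: (psf_lwhisker I (total_hom ff) (total_cell xx))).
- abstract (move=> a b c f g h x aa bb cc ff gg hh xx; apply: total_eq_over;
    exact: (psf_rwhisker I (total_hom hh) (total_cell xx))).
- move=> a aa.
  exact: disp_id2_inv.
- move=> a b c f g aa bb cc ff gg.
  exact: disp_id2_inv.
Defined.

Section DispCompPsfunctor.
Context {B1 B2 B3 : bicat}
  {D1 : disp_bicat B1} {D2 : disp_bicat B2} {D3 : disp_bicat B3}
  {F : psfunctor B1 B2} {G : psfunctor B2 B3}
  (FF : disp_psfunctor D1 D2 F) (GG : disp_psfunctor D2 D3 G).

Definition disp_comp_psfunctor_data : disp_psfunctor_data D1 D3 (comp_psfunctor F G) :=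
  @Build_disp_psfunctor_data B1 B3 D1 D3 (comp_psfunctor F G)
    (fun a aa => GG _ (FF _ aa))
    (fun a b f aa bb ff => dpsf_hom GG (dpsf_hom FF ff))
    (fun a b f g x aa bb ff gg xx => dpsf_cell GG (dpsf_cell FF xx))
    (fun a aa => dpsf_id GG (FF _ aa) •• dpsf_cell GG (dpsf_id FF aa))
    (fun a b c f g aa bb cc ff gg =>
      dpsf_comp GG (dpsf_hom FF ff) (dpsf_hom FF gg)
        •• dpsf_cell GG (dpsf_comp FF ff gg)).

Definition disp_comp_psfunctor : disp_psfunctor D1 D3 (comp_psfunctor F G).
Proof.
pose T := comp_psfunctor (total_psfunctor FF) (total_psfunctor GG).
exists disp_comp_psfunctor_data.
- abstract (move=> a b f aa bb ff; apply: total_eq_over;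
    exact: (psf_id2 T (total_hom ff))).
- abstract (move=> a b f g h x y aa bb ff gg hh xx yy; apply: total_eq_over;
    exact: (psf_vcomp T (total_cell xx) (total_cell yy))).
- abstract (move=> a b f aa bb ff; apply: total_eq_over;
    exact: (psf_lunitor T (total_hom ff))).
- abstract (move=> a b f aa bb ff; apply: total_eq_over;
    exact: (psf_runitor T (total_hom ff))).
- abstract (move=> a b c d f g h aa bb cc dd ff gg hh; apply: total_eq_over;
    exact: (psf_lassociator T (total_hom ff) (total_hom gg) (total_hom hh))).
- abstract (move=> a b c f g h x aa bb cc ff gg hh xx; apply: total_eq_over;
    exact: (psf_lwhisker T (total_hom ff) (total_cell xx))).
- abstract (move=> a b c f g h x aa bb cc ff gg hh xx; apply: total_eq_over;
    exact: (psf_rwhisker T (total_hom hh) (total_cell xx))).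
- move=> a aa.
  exact (disp_vcomp_inv (dpsf_id_inv GG _) (dpsf_cell_inv GG (dpsf_id_inv FF aa))).
- move=> a b c f g aa bb cc ff gg.
  exact (disp_vcomp_inv (dpsf_comp_inv GG _ _)
    (dpsf_cell_inv GG (dpsf_comp_inv FF ff gg))).
Defined.

End DispCompPsfunctor.

Record disp_pstrans_data {B C : bicat} {D1 : disp_bicat B} {D2 : disp_bicat C}
    {F G : psfunctor B C} (η : pstrans F G)
    (FF : disp_psfunctor D1 D2 F) (GG : disp_psfunctor D1 D2 G) := {
  dpst_ob :> forall {a : B} (aa : D1 a), FF a aa -->[η a] GG a aa;
  dpst_hom : forall {a b : B} {f : a --> b} {aa : D1 a} {bb : D1 b} (ff : aa -->[f] bb),
    dpst_ob aa ·· dpsf_hom GG ff ==>[pst_hom η f] dpsf_hom FF ff ·· dpst_ob bb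
}.

Record disp_pstrans {B C : bicat} {D1 : disp_bicat B} {D2 : disp_bicat C}
    {F G : psfunctor B C} (η : pstrans F G)
    (FF : disp_psfunctor D1 D2 F) (GG : disp_psfunctor D1 D2 G) := {
  dpst_data :> disp_pstrans_data η FF GG;
  dpst_natural : forall (a b : B) (f g : a --> b) (x : f ==> g) (aa : D1 a) (bb : D1 b)
      (ff : aa -->[f] bb) (gg : aa -->[g] bb) (xx : ff ==>[x] gg),
    (dpst_data a aa ◃◃ dpsf_cell GG xx) •• dpst_hom dpst_data gg
    =[pst_natural η x]
    dpst_hom dpst_data ff •• (dpsf_cell FF xx ▹▹ dpst_data b bb);
  dpst_id : forall (a : B) (aa : D1 a),
    (dpst_data a aa ◃◃ dpsf_id GG aa) •• dpst_hom dpst_data (disp_id1 aa)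
    =[pst_id η a]
    (disp_runitor (dpst_data a aa) •• disp_linvunitor (dpst_data a aa))
      •• (dpsf_id FF aa ▹▹ dpst_data a aa);
  dpst_comp : forall (a b c : B) (f : a --> b) (g : b --> c)
      (aa : D1 a) (bb : D1 b) (cc : D1 c) (ff : aa -->[f] bb) (gg : bb -->[g] cc),
    (dpst_data a aa ◃◃ dpsf_comp GG ff gg) •• dpst_hom dpst_data (ff ·· gg)
    =[pst_comp η f g]
    ((((disp_lassociator (dpst_data a aa) (dpsf_hom GG ff) (dpsf_hom GG gg)
          •• (dpst_hom dpst_data ff ▹▹ dpsf_hom GG gg))
         •• disp_rassociator (dpsf_hom FF ff) (dpst_data b bb) (dpsf_hom GG gg))
        •• (dpsf_hom FF ff ◃◃ dpst_hom dpst_data gg))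
       •• disp_lassociator (dpsf_hom FF ff) (dpsf_hom FF gg) (dpst_data c cc))
      •• (dpsf_comp FF ff gg ▹▹ dpst_data c cc);
  dpst_hom_inv : forall (a b : B) (f : a --> b) (aa : D1 a) (bb : D1 b)
      (ff : aa -->[f] bb),
    is_disp_invertible (pst_hom_inv η f) (dpst_hom dpst_data ff)
}.

Section TotalPstrans.
Context {B C : bicat} {D1 : disp_bicat B} {D2 : disp_bicat C}
  {F G : psfunctor B C} {η : pstrans F G}
  {FF : disp_psfunctor D1 D2 F} {GG : disp_psfunctor D1 D2 G}.

Definition total_pstrans_data (ηη : disp_pstrans_data η FF GG) :
  pstrans_data (total_psfunctor FF) (total_psfunctor GG) :=
  @Build_pstrans_data (∫D1) (∫D2) (total_psfunctor FF) (total_psfunctor GG)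
    (fun a => total_hom (ηη _ (projT2 a)))
    (fun a b f => total_cell (dpst_hom ηη (projT2 f))).

Definition total_pstrans (ηη : disp_pstrans η FF GG) :
  pstrans (total_psfunctor FF) (total_psfunctor GG).
Proof.
exists (total_pstrans_data ηη).
- abstract (by move=> *; exact: eq_over_total (dpst_natural _ _)).
- abstract (by move=> *; exact: eq_over_total (dpst_id _ _)).
- abstract (by move=> *; exact: eq_over_total (dpst_comp _ _ _)).
- move=> a b f; exact: total_is_invertible (dpst_hom_inv ηη (projT2 f)).
Defined.

End TotalPstrans.

Definition disp_id_pstrans_data {B C : bicat} {D1 : disp_bicat B} {D2 : disp_bicat C}
  {F : psfunctor B C} (FF : disp_psfunctor D1 D2 F) :
  disp_pstrans_data (id_pstrans F) FF FF :=
  @Build_disp_pstrans_data _ _ _ _ _ _ (id_pstrans F) FF FF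
    (fun a aa => disp_id1 (FF a aa))
    (fun a b f aa bb ff =>
      disp_lunitor (dpsf_hom FF ff) •• disp_rinvunitor (dpsf_hom FF ff)).

Definition disp_id_pstrans {B C : bicat} {D1 : disp_bicat B} {D2 : disp_bicat C}
  {F : psfunctor B C} (FF : disp_psfunctor D1 D2 F) :
  disp_pstrans (id_pstrans F) FF FF.
Proof.
pose T := id_pstrans (total_psfunctor FF).
exists (disp_id_pstrans_data FF).
- abstract (move=> a b f g x aa bb ff gg xx; apply: total_eq_over;
    exact: (pst_natural T (total_cell xx))).
- abstract (move=> a aa; apply: total_eq_over; exact: (pst_id T (total_ob aa))).
- abstract (move=> a b c f g aa bb cc ff gg; apply: total_eq_over;
    exact: (pst_comp T (total_hom ff) (total_hom gg))).
- move=> a b f aa bb ff.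
  exact (disp_vcomp_inv (disp_lunitor_inv _) (disp_rinvunitor_inv _)).
Defined.

Section DispCompPstrans.
Context {B C : bicat} {D1 : disp_bicat B} {D2 : disp_bicat C}
  {F G H : psfunctor B C} {η : pstrans F G} {θ : pstrans G H}
  {FF : disp_psfunctor D1 D2 F} {GG : disp_psfunctor D1 D2 G}
  {HH : disp_psfunctor D1 D2 H}.

Definition disp_comp_pstrans_data
  (ηη : disp_pstrans_data η FF GG) (θθ : disp_pstrans_data θ GG HH) :
  disp_pstrans_data (comp_pstrans η θ) FF HH :=
  @Build_disp_pstrans_data _ _ _ _ _ _ (comp_pstrans η θ) FF HH
    (fun a aa => ηη a aa ·· θθ a aa)
    (fun a b f aa bb ff =>
      (((disp_rassociator (ηη a aa) (θθ a aa) (dpsf_hom HH ff)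
           •• (ηη a aa ◃◃ dpst_hom θθ ff))
          •• disp_lassociator (ηη a aa) (dpsf_hom GG ff) (θθ b bb))
         •• (dpst_hom ηη ff ▹▹ θθ b bb))
        •• disp_rassociator (dpsf_hom FF ff) (ηη b bb) (θθ b bb)).

Definition disp_comp_pstrans (ηη : disp_pstrans η FF GG) (θθ : disp_pstrans θ GG HH) :
  disp_pstrans (comp_pstrans η θ) FF HH.
Proof.
pose T := comp_pstrans (total_pstrans ηη) (total_pstrans θθ).
exists (disp_comp_pstrans_data ηη θθ).
- abstract (move=> a b f g x aa bb ff gg xx; apply: total_eq_over;
    exact: (pst_natural T (total_cell xx))).
- abstract (move=> a aa; apply: total_eq_over; exact: (pst_id T (total_ob aa))).
- abstract (move=> a b c f g aa bb cc ff gg; apply: total_eq_over;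
    exact: (pst_comp T (total_hom ff) (total_hom gg))).
- move=> a b f aa bb ff.
  exact (disp_vcomp_inv (disp_vcomp_inv (disp_vcomp_inv (disp_vcomp_inv
    (disp_rassociator_inv _ _ _) (disp_lwhisker_inv _ (dpst_hom_inv θθ ff)))
    (disp_lassociator_inv _ _ _)) (disp_rwhisker_inv _ (dpst_hom_inv ηη ff)))
    (disp_rassociator_inv _ _ _)).
Defined.

End DispCompPstrans.

Record disp_modification {B C : bicat} {D1 : disp_bicat B} {D2 : disp_bicat C}
    {F G : psfunctor B C} {σ τ : pstrans F G} (m : modification σ τ)
    {FF : disp_psfunctor D1 D2 F} {GG : disp_psfunctor D1 D2 G}
    (σσ : disp_pstrans σ FF GG) (ττ : disp_pstrans τ FF GG) := {
  dmod_cell :> forall {a : B} (aa : D1 a), σσ a aa ==>[m a] ττ a aa;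
  dmod_natural : forall (a b : B) (f : a --> b) (aa : D1 a) (bb : D1 b)
      (ff : aa -->[f] bb),
    dpst_hom σσ ff •• (dpsf_hom FF ff ◃◃ dmod_cell bb)
    =[mod_natural m f] (dmod_cell aa ▹▹ dpsf_hom GG ff) •• dpst_hom ττ ff
}.

Record disp_invertible_modification {B C : bicat} {D1 : disp_bicat B} {D2 : disp_bicat C}
    {F G : psfunctor B C} {σ τ : pstrans F G} (m : invertible_modification σ τ)
    {FF : disp_psfunctor D1 D2 F} {GG : disp_psfunctor D1 D2 G}
    (σσ : disp_pstrans σ FF GG) (ττ : disp_pstrans τ FF GG) := {
  disp_inv_mod :> disp_modification m σσ ττ;
  disp_inv_mod_inv : forall (a : B) (aa : D1 a),
    is_disp_invertible (inv_mod_inv m a) (disp_inv_mod a aa)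
}.

Record disp_biequivalence {B C : bicat} (D1 : disp_bicat B) (D2 : disp_bicat C)
    (L : biequivalence B C) := {
  dbieq_psf :> disp_psfunctor D1 D2 L;
  dbieq_inv : disp_psfunctor D2 D1 (bieq_inv L);
  dbieq_eta : disp_pstrans (bieq_eta L)
    (disp_comp_psfunctor dbieq_inv dbieq_psf) (disp_id_psfunctor D2);
  dbieq_eta_i : disp_pstrans (bieq_eta_i L)
    (disp_id_psfunctor D2) (disp_comp_psfunctor dbieq_inv dbieq_psf);
  dbieq_eps : disp_pstrans (bieq_eps L)
    (disp_comp_psfunctor dbieq_psf dbieq_inv) (disp_id_psfunctor D1);
  dbieq_eps_i : disp_pstrans (bieq_eps_i L)
    (disp_id_psfunctor D1) (disp_comp_psfunctor dbieq_psf dbieq_inv);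
  dbieq_mod1 : disp_invertible_modification (bieq_mod1 L)
    (disp_comp_pstrans dbieq_eta dbieq_eta_i) (disp_id_pstrans _);
  dbieq_mod2 : disp_invertible_modification (bieq_mod2 L)
    (disp_comp_pstrans dbieq_eta_i dbieq_eta) (disp_id_pstrans _);
  dbieq_mod3 : disp_invertible_modification (bieq_mod3 L)
    (disp_comp_pstrans dbieq_eps dbieq_eps_i) (disp_id_pstrans _);
  dbieq_mod4 : disp_invertible_modification (bieq_mod4 L)
    (disp_comp_pstrans dbieq_eps_i dbieq_eps) (disp_id_pstrans _)
}.

(* Main.v *)
(* Every component of the biequivalence on total bicategories pairs a component of [L]
   with one of [LL], and each law is the displayed law read as an equality of pairs.
   The total of a displayed identity pseudofunctor sends [a] to
   [existT _ (projT1 a) (projT2 a)], which is not convertible to [a]; the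
   pseudotransformations to and from the identity are therefore built directly, which
   works because homs and 2-cells of a total bicategory depend on their endpoints only
   through [projT1] and [projT2]. *)
From Stdlib Require Import ssreflect.
Require Import Defs.

Section TotalInvertible.
Context {B : bicat} {D : disp_bicat B}.

(* Unlike in [total_is_invertible], nothing needs to be a syntactic pair here. *)
Definition is_invertible_of_disp {a b : ∫D} {f g : a --> b} {x : f ==> g}
  {ix : is_invertible (projT1 x)} (ixx : is_disp_invertible ix (projT2 x)) :
  is_invertible x :=
  @Build_is_invertible (∫D) a b f g x
    (existT _ (inv_cell ix) (disp_inv_cell ixx))
    (eq_over_total (disp_inv_cell_right ixx)) (eq_over_total (disp_inv_cell_left ixx)).

End TotalInvertible.

Section TotalUnits.
Context {B C : bicat} {D1 : disp_bicat B} {D2 : disp_bicat C}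
  {F : psfunctor B C} {G : psfunctor C B}
  {FF : disp_psfunctor D1 D2 F} {GG : disp_psfunctor D2 D1 G}.

Section ToId.
Context {ε : pstrans (comp_psfunctor F G) (id_psfunctor B)}
  (εε : disp_pstrans ε (disp_comp_psfunctor FF GG) (disp_id_psfunctor D1)).

(** [total_pstrans] does not fit on the composite side either: the total of
    [disp_comp_psfunctor FF GG] and the composite of the totals share their data up to conversion,
    but carry different opaque proofs of the laws. *)
Definition total_pstrans_to_id_data :
  pstrans_data (comp_psfunctor (total_psfunctor FF) (total_psfunctor GG))
    (id_psfunctor (∫D1)) :=
  @Build_pstrans_data (∫D1) (∫D1)
    (comp_psfunctor (total_psfunctor FF) (total_psfunctor GG)) (id_psfunctor (∫D1))
    (fun a => existT _ (ε (projT1 a)) (εε _ (projT2 a)))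
    (fun a b f => existT _ (pst_hom ε (projT1 f)) (dpst_hom εε (projT2 f))).

Definition total_pstrans_to_id :
  pstrans (comp_psfunctor (total_psfunctor FF) (total_psfunctor GG))
    (id_psfunctor (∫D1)).
Proof.
exists total_pstrans_to_id_data.
(* Composition of total pseudofunctors is computed componentwise, so both sides reduce to pairs and
   [eq_over_total] matches by conversion. *)
- abstract (move=> a b f g x;
    exact: (eq_over_total (dpst_natural εε (projT2 x)))).
- abstract (move=> a; exact: (eq_over_total (dpst_id εε (projT2 a)))).
- abstract (move=> a b c f g;
    exact: (eq_over_total (dpst_comp εε (projT2 f) (projT2 g)))).
- move=> a b f; apply: is_invertible_of_disp; exact: (dpst_hom_inv εε (projT2 f)).
Defined.

End ToId.

Section FromId.
Context {ε : pstrans (id_psfunctor B) (comp_psfunctor F G)}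
  (εε : disp_pstrans ε (disp_id_psfunctor D1) (disp_comp_psfunctor FF GG)).

Definition total_pstrans_from_id_data :
  pstrans_data (id_psfunctor (∫D1))
    (comp_psfunctor (total_psfunctor FF) (total_psfunctor GG)) :=
  @Build_pstrans_data (∫D1) (∫D1)
    (id_psfunctor (∫D1)) (comp_psfunctor (total_psfunctor FF) (total_psfunctor GG))
    (fun a => existT _ (ε (projT1 a)) (εε _ (projT2 a)))
    (fun a b f => existT _ (pst_hom ε (projT1 f)) (dpst_hom εε (projT2 f))).

Definition total_pstrans_from_id :
  pstrans (id_psfunctor (∫D1))
    (comp_psfunctor (total_psfunctor FF) (total_psfunctor GG)).
Proof.
exists total_pstrans_from_id_data.
- abstract (move=> a b f g x;
    exact: (eq_over_total (dpst_natural εε (projT2 x)))).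
- abstract (move=> a; exact: (eq_over_total (dpst_id εε (projT2 a)))).
- abstract (move=> a b c f g;
    exact: (eq_over_total (dpst_comp εε (projT2 f) (projT2 g)))).
- move=> a b f; apply: is_invertible_of_disp; exact: (dpst_hom_inv εε (projT2 f)).
Defined.

End FromId.

Context {ε : pstrans (comp_psfunctor F G) (id_psfunctor B)}
  {ε_i : pstrans (id_psfunctor B) (comp_psfunctor F G)}
  {εε : disp_pstrans ε (disp_comp_psfunctor FF GG) (disp_id_psfunctor D1)}
  {εε_i : disp_pstrans ε_i (disp_id_psfunctor D1) (disp_comp_psfunctor FF GG)}.

Definition total_modification_on_comp
  {m : invertible_modification (comp_pstrans ε ε_i) (id_pstrans _)}
  (mm : disp_invertible_modification m
    (disp_comp_pstrans εε εε_i) (disp_id_pstrans _)) :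
  invertible_modification
    (comp_pstrans (total_pstrans_to_id εε) (total_pstrans_from_id εε_i))
    (id_pstrans _).
Proof.
unshelve eexists.
- exists (fun a => existT _ (m (projT1 a)) (mm _ (projT2 a))).
  (* The 2-cells of the composite transformation reduce to the pasting in [comp_pstrans ε ε_i]
     paired with the pasting of the same shape in [disp_comp_pstrans εε εε_i]. *)
  abstract (move=> a b f; exact: (eq_over_total (dmod_natural mm (projT2 f)))).
- move=> a; apply: is_invertible_of_disp; exact: (disp_inv_mod_inv mm (projT2 a)).
Defined.

Definition total_modification_on_id
  {m : invertible_modification (comp_pstrans ε_i ε) (id_pstrans _)}
  (mm : disp_invertible_modification m
    (disp_comp_pstrans εε_i εε) (disp_id_pstrans _)) :
  invertible_modification
    (comp_pstrans (total_pstrans_from_id εε_i) (total_pstrans_to_id εε))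
    (id_pstrans _).
Proof.
unshelve eexists.
- exists (fun a => existT _ (m (projT1 a)) (mm _ (projT2 a))).
  abstract (move=> a b f; exact: (eq_over_total (dmod_natural mm (projT2 f)))).
- move=> a; apply: is_invertible_of_disp; exact: (disp_inv_mod_inv mm (projT2 a)).
Defined.

End TotalUnits.

Definition total_biequivalence {B C : bicat} {L : biequivalence B C}
  {D1 : disp_bicat B} {D2 : disp_bicat C} (LL : disp_biequivalence D1 D2 L) :
  biequivalence (∫D1) (∫D2) :=
  {| bieq_psf := total_psfunctor LL;
     bieq_inv := total_psfunctor (dbieq_inv LL);
     (* The same constructions serve both sides: [F], [G] are [bieq_inv L], [L] for [η], and [L],
        [bieq_inv L] for [ε]. *)
     bieq_eta := total_pstrans_to_id (dbieq_eta LL);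
     bieq_eta_i := total_pstrans_from_id (dbieq_eta_i LL);
     bieq_eps := total_pstrans_to_id (dbieq_eps LL);
     bieq_eps_i := total_pstrans_from_id (dbieq_eps_i LL);
     bieq_mod1 := total_modification_on_comp (dbieq_mod1 LL);
     bieq_mod2 := total_modification_on_id (dbieq_mod2 LL);
     bieq_mod3 := total_modification_on_comp (dbieq_mod3 LL);
     bieq_mod4 := total_modification_on_id (dbieq_mod4 LL) |}.

Theorem mainTheorem11 (B C : bicat) (L : biequivalence B C)
    (D1 : disp_bicat B) (D2 : disp_bicat C) (LL : disp_biequivalence D1 D2 L) :
  { E : biequivalence (∫D1) (∫D2) | bieq_psf E = total_psfunctor LL }.
Proof.
(* The field [bieq_psf] was chosen to be [total_psfunctor LL] itself, so the equation holds by
   computation. *)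
exact (exist _ (total_biequivalence LL) eq_refl).
Qed.
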